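(* Let $P$ be an $r$-differential poset such that: (i) the down maps $D_n:\mathbb{Z}P_n\to\mathbb{Z}P_{n-1}$ are surjective for all $n\ge1$; (ii) there exists $l\ge0$ such that $\Delta p_n\ge\Delta p_{n-1-\delta_{r,1}}+1$ for every $n\ge l+1$ (where $\delta_{r,1}=1$ if $r=1$ and $0$ otherwise); (iii) the maps $DU_n$ have rational canonical form over $\mathbb{Z}$ for all $n\in\{0,1,\dots,l\}$. Then $DU_n$ has rational canonical form over $\mathbb{Z}$ for all $n\ge0$; equivalently, $[DU_n]+xI_{p_n}$ has Smith normal form over $\mathbb{Z}[x]$ for all $n\ge0$.
   Context: For a positive integer $r$, a poset $P$ is $r$-differential if: (D1) $P$ is graded, locally finite, has all rank sizes finite and a unique minimum element; (D2) if two distinct elements of $P$ both cover exactly $k$ common elements, then exactly $k$ elements cover them both; (D3) if an element covers $k$ elements then it is covered by exactly $k+r$ elements. $P_n$ is the $n$-th rank (empty for $n<0$), $p_n=|P_n|$, $\Delta p_n=p_n-p_{n-1}$, and $\mathbb{Z}P_n\cong\mathbb{Z}^{p_n}$ is the free $\mathbb{Z}$-module with basis $P_n$. $U_n:\mathbb{Z}P_n\to\mathbb{Z}P_{n+1}$ sends an element to the sum of all elements covering it; $D_n:\mathbb{Z}P_n\to\mathbb{Z}P_{n-1}$ sends an element to the sum of all elements it covers; $DU_n=D_{n+1}U_n$, with matrix $[DU_n]$ in the standard basis. An endomorphism $\varphi$ of a free $\mathbb{Z}$-module $M$ of finite rank has rational canonical form over $\mathbb{Z}$ if, viewing $M$ as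 a $\mathbb{Z}[x]$-module with $x$ acting by $\varphi$, $M=V_1\oplus\cdots\oplus V_k$ with $V_i$ cyclic $\mathbb{Z}[x]$-submodules, $\operatorname{Ann}(V_i)=(a_i(x))$, each $a_i$ monic non-constant in $\mathbb{Z}[x]$, and $a_1\mid a_2\mid\cdots\mid a_k$. A matrix over a commutative ring $R$ has Smith normal form over $R$ if it can be multiplied on both sides by invertible matrices over $R$ to obtain a diagonal matrix whose diagonal entries satisfy $s_1\mid s_2\mid\cdots$. *)

(* Defs.v *)
From HB Require Import structures.
From mathcomp Require Import all_boot all_order all_algebra.
Set Implicit Arguments. Unset Strict Implicit. Unset Printing Implicit Defensive.
Import Order.TTheory GRing.Theory Num.Theory.
Local Open Scope ring_scope.

(* A graded poset with finite ranks is encoded by its Hasse diagram: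
   rank n is the finite set 'I_(p n) (so p n = |P_n|), and
   C n x y  (x : 'I_(p n), y : 'I_(p n.+1)) means "y covers x". *)
Section Poset.
Variables (p : nat -> nat) (C : forall n, 'I_(p n) -> 'I_(p n.+1) -> bool).

Definition nup n (x : 'I_(p n)) : nat := #|[set z : 'I_(p n.+1) | C x z]|.

Definition ndown n : 'I_(p n) -> nat :=
  match n as n0 return 'I_(p n0) -> nat with
  | 0 => fun _ => 0%N
  | m.+1 => fun x => #|[set w : 'I_(p m) | C w x]|
  end.

Definition ncommon_up n (x y : 'I_(p n)) : nat :=
  #|[set z : 'I_(p n.+1) | C x z && C y z]|.

Definition ncommon_down n : 'I_(p n) -> 'I_(p n) -> nat :=
  match n as n0 return 'I_(p n0) -> 'I_(p n0) -> nat with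
  | 0 => fun _ _ => 0%N
  | m.+1 => fun x y => #|[set w : 'I_(p m) | C w x && C w y]|
  end.

(* r-differential poset (D1)-(D3).  D1: graded with finite ranks (built into
   the encoding), unique minimum: P_0 is a singleton and every element of
   positive rank covers some element. *)
Definition differential (r : nat) : Prop :=
  [/\ p 0 = 1%N,
      (forall n (y : 'I_(p n.+1)), exists x : 'I_(p n), C x y),
      (forall n (x y : 'I_(p n)), x != y -> ncommon_down x y = ncommon_up x y)
    & (forall n (x : 'I_(p n)), nup x = (ndown x + r)%N)].

(* matrix of D_{n+1} : Z P_{n+1} -> Z P_n, acting on row vectors:
   row y is the image of y *)
Definition Dmx n : 'M[int]_(p n.+1, p n) :=
  \matrix_(y, x) (C x y : nat)%:Z.

(* matrix of U_n : Z P_n -> Z P_{n+1}, acting on row vectors *)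
Definition Umx n : 'M[int]_(p n, p n.+1) :=
  \matrix_(x, y) (C x y : nat)%:Z.

(* [DU_n] = U_n followed by D_{n+1}; entry (x,x') = #elements covering both
   (this matrix is symmetric, so row/column conventions agree). *)
Definition DUmx n : 'M[int]_(p n) := Umx n *m Dmx n.

Definition pZ (k : int) : int :=
  match k with Posz n => (p n)%:Z | Negz _ => 0 end.

Definition dp (k : int) : int := pZ k - pZ (k - 1).

End Poset.

Definition polyact N (A : 'M[int]_N) (f : {poly int}) (v : 'rV[int]_N) : 'rV[int]_N :=
  \sum_(i < size f) f`_i *: iter i (fun w => w *m A) v.

Definition pdvd (a b : {poly int}) : Prop := exists g : {poly int}, b = g * a.

(* The endomorphism v |-> v *m A of Z^N has rational canonical form over Z:
   Z^N = V_1 (+) ... (+) V_k (internal direct sum), V_i = Z[x] v_i cyclic,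
   Ann(V_i) = (a_i), a_i monic non-constant, a_1 | a_2 | ... | a_k. *)
Definition has_rcf N (A : 'M[int]_N) : Prop :=
  exists (k : nat) (v : 'I_k -> 'rV[int]_N) (a : 'I_k -> {poly int}),
    [/\
        (forall m : 'rV[int]_N, exists f : 'I_k -> {poly int},
             m = \sum_(i < k) polyact A (f i) (v i)),
        (forall f : 'I_k -> {poly int},
             \sum_(i < k) polyact A (f i) (v i) = 0 ->
             forall i, polyact A (f i) (v i) = 0),
        (forall i (f : {poly int}), polyact A f (v i) = 0 <-> pdvd (a i) f),
        (forall i, a i \is monic /\ (1 < size (a i))%N)
      & (forall i j : 'I_k, (i <= j)%N -> pdvd (a i) (a j))].

Definition has_snf (R : comUnitRingType) m n (M : 'M[R]_(m, n)) : Prop :=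
  exists (L : 'M[R]_m) (Q : 'M[R]_n) (d : nat -> R),
    [/\ L \in unitmx, Q \in unitmx,
        L *m M *m Q = \matrix_(i, j) (if (i : nat) == j then d i else 0)
      & forall i j : nat, (i <= j < minn m n)%N -> exists c : R, d j = c * d i].

(* Main.v *)
Require Import Defs.
From HB Require Import structures.
From mathcomp Require Import all_boot all_order all_algebra.
From mathcomp Require Import zify ring.
Import Order.TTheory GRing.Theory Num.Theory.
Set Implicit Arguments. Unset Strict Implicit. Unset Printing Implicit Defensive.
Local Open Scope ring_scope.

(** Since [DU_{n+1} = UD_{n+1} + r], it suffices to decompose ZP_{n+1} as a Z[x]-module
    with [x] acting by UD.  The surjection D makes it an extension of ZP_n (with [x] acting
    by DU_n) by K = ker D, on which [x] acts as 0.  If ZP_n is the direct sum of the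
    Z[x]/(a_i), padded with trivial summands, the extension is given by classes [e_i] in
    K / a_i(0) K, and [a_i(UD)] maps a lift of the i-th generator to [e_i].  Because U is the
    transpose of D it is split injective, and this makes the rows of (diag a_i(0) | e)
    unimodular.  If the last [rank K] classes lift to a basis of K and all earlier [a_i(0)]
    are units, then ZP_{n+1} is the sum of the Z[x]/(a_i) and Z[x]/(x a_i).  Such a lift
    exists when the smallest of the last [rank K] numbers [a_i(0)] divides 3.

    The [a_i] are products of distinct factors [x - r j], and at most Delta p_{n+1-j} of
    them vanish at [r j].  Reducing DU_n modulo a prime divisor of [r j] gives
    Delta p_{n+1-j} <= Delta p_{n+1} whenever [r j <> 1].  Together with hypothesis (ii)
    this leaves no root other than 1 and, for r = 1, the root 3. *)

(** * Decompositions into cyclic modules *)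

(** [horner_mx] is typed only for size [n.+1], and [p n] is no syntactic successor; hence the
    separate case of size 0. *)
Definition mxeval N : 'M[int]_N -> {poly int} -> 'M[int]_N :=
  match N with
  | 0 => fun _ _ => 0
  | n.+1 => fun A f => horner_mx A f
  end.

Section MxEval.
Variable N : nat.
Implicit Types (A : 'M[int]_N) (f g : {poly int}) (v : 'rV[int]_N).

Lemma mxevalD A f g : mxeval A (f + g) = mxeval A f + mxeval A g.
Proof. by case: N A => [|n] A /=; rewrite ?addr0 ?rmorphD. Qed.

Lemma mxevalN A f : mxeval A (- f) = - mxeval A f.
Proof. by case: N A => [|n] A /=; rewrite ?oppr0 ?rmorphN. Qed.

Lemma mxevalB A f g : mxeval A (f - g) = mxeval A f - mxeval A g.
Proof. by rewrite mxevalD mxevalN. Qed.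

Lemma mxeval0 A : mxeval A 0 = 0.
Proof. by case: N A => [|n] A //=; rewrite rmorph0. Qed.

Lemma mxevalM A f g : mxeval A (f * g) = mxeval A f *m mxeval A g.
Proof. by case: N A => [|n] A /=; rewrite ?mulmx0 ?rmorphM. Qed.

Lemma mxevalC A c : mxeval A c%:P = c%:M.
Proof.
case: N A => [|n] A /=; last by rewrite horner_mx_C.
by apply/matrixP; case.
Qed.

Lemma mxeval1 A : mxeval A 1 = 1%:M.
Proof. exact: mxevalC. Qed.

Lemma mxevalX A : mxeval A 'X = A.
Proof. by case: N A => [|n] A /=; rewrite ?horner_mx_X // [A]thinmx0. Qed.

Lemma mxevalZ A c f : mxeval A (c *: f) = c *: mxeval A f.
Proof. by rewrite -mul_polyC mxevalM mxevalC mul_scalar_mx. Qed.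

Lemma mxeval_sum A I (s : seq I) (P : pred I) (F : I -> {poly int}) :
  mxeval A (\sum_(i <- s | P i) F i) = \sum_(i <- s | P i) mxeval A (F i).
Proof. exact: (big_morph _ (mxevalD A) (mxeval0 A)). Qed.

Lemma mxeval_addC A c f : mxeval (A + c%:M) f = mxeval A (f \Po ('X + c%:P)).
Proof.
elim/poly_ind: f => [|f a IH]; first by rewrite comp_poly0 !mxeval0.
rewrite comp_polyD comp_polyM comp_polyX comp_polyC !mxevalD !mxevalM IH.
by rewrite mxevalD !mxevalX !mxevalC.
Qed.

Lemma polyactE A f v : polyact A f v = v *m mxeval A f.
Proof.
have E i : iter i (fun w => w *m A) v = v *m mxeval A 'X^i.
  elim: i => [|i IH] /=; first by rewrite mxeval1 mulmx1.
  by rewrite IH exprSr mxevalM mxevalX mulmxA.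
rewrite /polyact -[in RHS](coefK f) poly_def mxeval_sum mulmx_sumr.
by apply: eq_bigr => i _; rewrite E mxevalZ scalemxAr.
Qed.

End MxEval.

Lemma mxeval_intertwine N M (B : 'M[int]_N) (A : 'M[int]_M) (D : 'M[int]_(N, M)) f :
  B *m D = D *m A -> mxeval B f *m D = D *m mxeval A f.
Proof.
move=> BD; elim/poly_ind: f => [|f a IH]; first by rewrite !mxeval0 mul0mx mulmx0.
rewrite !mxevalD !mxevalM !mxevalC !mxevalX mulmxDl mulmxDr -mulmxA BD !mulmxA IH.
by rewrite scalar_mxC.
Qed.

Lemma pdvd_refl a : pdvd a a.
Proof. by exists 1; rewrite mul1r. Qed.

Lemma pdvd1 a : pdvd 1 a.
Proof. by exists a; rewrite mulr1. Qed.

(* The constant polynomial [a i = 1], which forces [v i = 0], is allowed, so that a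
   decomposition can be padded to any larger number of summands. *)
Definition cyclic_decomp N (A : 'M[int]_N) (S : nat)
    (v : nat -> 'rV[int]_N) (a : nat -> {poly int}) : Prop :=
  [/\ (forall m : 'rV[int]_N, exists f : nat -> {poly int},
          m = \sum_(i < S) v i *m mxeval A (f i)),
      (forall f : nat -> {poly int}, \sum_(i < S) v i *m mxeval A (f i) = 0 ->
          forall i, (i < S)%N -> pdvd (a i) (f i)),
      (forall i, (i < S)%N -> v i *m mxeval A (a i) = 0),
      (forall i, (i < S)%N -> a i \is monic)
    & (forall i j, (i <= j < S)%N -> pdvd (a i) (a j))].

Lemma sum_single_ord (V : zmodType) S (i : 'I_S) (x : V) (F : nat -> V) :
  (forall j : nat, j != i -> F j = 0) -> F i = x -> \sum_(j < S) F j = x.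
Proof.
by move=> F0 Fi; rewrite (bigD1 i) //= Fi big1 ?addr0 // => j ji; apply: F0.
Qed.

(** Independence and the annihilators merge into one condition: a vanishing sum forces [a i] to
    divide [f i]. *)
Lemma has_rcf_cyclic_decomp N (A : 'M[int]_N) :
  has_rcf A -> exists S v a, cyclic_decomp A S v a
    /\ forall i, (i < S)%N -> (1 < size (a i))%N.
Proof.
case=> S [v] [a] [span indep ann mon chain].
pose e T (d : T) (g : 'I_S -> T) (i : nat) := if insub i is Some j then g j else d.
have eE T (d : T) g (i : 'I_S) : e T d g i = g i by rewrite /e valK.
exists S, (e _ 0 v), (e _ 0 a); split; last first.
  by move=> i lt_i; rewrite (eE _ _ _ (Ordinal lt_i)); have [] := mon (Ordinal lt_i).
split.
- move=> m; have [f ->] := span m; exists (e _ 0 f).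
  by apply: eq_bigr => i _; rewrite !eE polyactE.
- move=> f f0 i lt_i; rewrite (eE _ _ _ (Ordinal lt_i)).
  apply/ann; apply: (indep (fun i : 'I_S => f i) _ (Ordinal lt_i)).
  by rewrite -[RHS]f0; apply: eq_bigr => j _; rewrite eE polyactE.
- move=> i lt_i; rewrite !(eE _ _ _ (Ordinal lt_i)) -polyactE.
  by apply/ann/pdvd_refl.
- by move=> i lt_i; rewrite (eE _ _ _ (Ordinal lt_i)); have [] := mon (Ordinal lt_i).
- move=> i j /andP[le_ij lt_j]; have lt_i := leq_ltn_trans le_ij lt_j.
  by rewrite (eE _ _ _ (Ordinal lt_i)) (eE _ _ _ (Ordinal lt_j)); apply: chain.
Qed.

(** The trivial summands go in front: 1 divides everything, so the divisibility chain survives. *)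
Lemma cyclic_decomp_pad N (A : 'M[int]_N) m S v a : cyclic_decomp A S v a ->
  cyclic_decomp A (m + S) (fun i => if (i < m)%N then 0 else v (i - m)%N)
                          (fun i => if (i < m)%N then 1 else a (i - m)%N).
Proof.
case=> span indep ann mon chain.
have E (f : nat -> {poly int}) :
  \sum_(i < m + S) (if (i < m)%N then 0 else v (i - m)%N) *m mxeval A (f i)
  = \sum_(i < S) v i *m mxeval A (f (m + i)%N).
  rewrite big_split_ord /= big1 ?add0r => [|i _]; last by rewrite ltn_ord mul0mx.
  by apply: eq_bigr => i _; rewrite ltnNge leq_addr /= addKn.
split.
- move=> w; have [f ->] := span w; exists (fun i => f (i - m)%N).
  by rewrite (E (fun i => f (i - m)%N)); apply: eq_bigr => i _; rewrite addKn.
- move=> f; rewrite E => /(indep (fun i => f (m + i)%N)) f0 i lt_i.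
  case: ltnP => [_|le_mi]; first exact: pdvd1.
  by rewrite -{2}(subnKC le_mi); apply: f0; lia.
- by move=> i lt_i; case: ltnP => [_|le_mi]; rewrite ?mul0mx // ann //; lia.
- by move=> i lt_i; case: ltnP => [_|le_mi]; rewrite ?monic1 // mon //; lia.
- move=> i j lt_ij; case: (ltnP i m) => [_|le_mi]; first exact: pdvd1.
  have -> : (j < m)%N = false by lia.
  by apply: chain; lia.
Qed.

Lemma size_pdvd a b : b != 0 -> pdvd a b -> (size a <= size b)%N.
Proof.
move=> nz_b [g Eb]; move: nz_b; rewrite Eb mulf_eq0 negb_or => /andP[g0 a0].
rewrite size_mul //; move: g0; rewrite -size_poly_gt0.
by case: (size g) => // n _; rewrite addSn leq_addl.
Qed.

Lemma pdvd_small a b : pdvd a b -> (size b < size a)%N -> b = 0.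
Proof.
by move=> ab; apply: contraTeq => nz_b; rewrite -leqNgt size_pdvd.
Qed.

Lemma monic_size_le1 (f : {poly int}) : f \is monic -> (size f <= 1)%N -> f = 1.
Proof.
by move=> /monicP + /size1_polyC Ef; rewrite Ef lead_coefC => ->.
Qed.

(** Constant annihilators stand at the start of the chain. Induction strips them, and once [a 0] is
    non-constant so are all its multiples. *)
Lemma cyclic_decomp_has_rcf N (A : 'M[int]_N) S v a :
  cyclic_decomp A S v a -> has_rcf A.
Proof.
elim: S v a => [|S IH] v a dec.
  case: (dec) => span indep _ _ _; exists 0%N, (fun i => v i), (fun i => a i).
  split; [|by move=> ? ? []|by case..].
  by move=> m; have [f ->] := span m; exists (fun i => f i); rewrite !big_ord0.
case: (dec) => span indep ann mon chain.
have [sz1|sz] := leqP (size (a 0%N)) 1.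
  have a1 : a 0%N = 1 by apply: monic_size_le1 => //; exact: mon.
  have v0 : v 0%N = 0 by have:= ann 0%N isT; rewrite a1 mxeval1 mulmx1.
  apply: (IH (v \o succn) (a \o succn)); split=> /=.
  - move=> m; have [f ->] := span m; exists (f \o succn).
    by rewrite big_ord_recl v0 mul0mx add0r.
  - move=> f f0 i lt_i; apply: (indep (fun i => f i.-1) _ i.+1) => //.
    by rewrite big_ord_recl v0 mul0mx add0r.
  - by move=> i lt_i; apply: ann.
  - by move=> i lt_i; apply: mon.
  - by move=> i j lt_ij; apply: chain.
exists S.+1, (fun i => v i), (fun i => a i).
have annP (i : 'I_S.+1) f : polyact A f (v i) = 0 <-> pdvd (a i) f.
  rewrite polyactE; split=> [f0|[g ->]]; last first.
    by rewrite mulrC mxevalM mulmxA ann // mul0mx.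
  pose F j := if j == i :> nat then f else 0.
  have -> : f = F i by rewrite /F eqxx.
  apply: indep => //; apply: (@sum_single_ord _ _ i _ (fun j => v j *m mxeval A (F j))).
    by move=> j /negPf ji; rewrite /F ji mxeval0 mulmx0.
  by rewrite /F eqxx.
split=> //.
- move=> m; have [f ->] := span m; exists (fun i => f i).
  by apply: eq_bigr => i _; rewrite polyactE.
- move=> f f0 i; apply/annP.
  pose F j := if insub j is Some j' then f j' else 0.
  have FE (j : 'I_S.+1) : F j = f j by rewrite /F valK.
  rewrite -FE; apply: indep => //; rewrite -[RHS]f0.
  by apply: eq_bigr => j _; rewrite FE polyactE.
- move=> i; split; first exact: mon.
  apply: leq_trans sz _.
  exact: size_pdvd (monic_neq0 (mon _ (ltn_ord i))) (chain 0%N i (ltn_ord i)).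
- by move=> i j le_ij; apply: chain; rewrite le_ij /=.
Qed.

(** Substituting x - c for x is an automorphism of Z[x], so the same generators serve for the
    shifted action. *)
Lemma cyclic_decomp_addC N (A : 'M[int]_N) c S v a : cyclic_decomp A S v a ->
  cyclic_decomp (A + c%:M) S v (fun i => a i \Po ('X - c%:P)).
Proof.
have K1 f : (f \Po ('X - c%:P)) \Po ('X + c%:P) = f.
  by rewrite -comp_polyA comp_polyB comp_polyX comp_polyC addrK comp_polyXr.
have K2 f : (f \Po ('X + c%:P)) \Po ('X - c%:P) = f.
  by rewrite -comp_polyA comp_polyD comp_polyX comp_polyC subrK comp_polyXr.
case=> span indep ann mon chain; split.
- move=> m; have [f ->] := span m; exists (fun i => f i \Po ('X - c%:P)).
  by apply: eq_bigr => i _; rewrite mxeval_addC K1.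
- move=> f f0 i lt_i.
  have [|g E] := indep (fun i => f i \Po ('X + c%:P)) _ i lt_i.
    by rewrite -[RHS]f0; apply: eq_bigr => j _; rewrite mxeval_addC.
  by exists (g \Po ('X - c%:P)); rewrite -comp_polyM -E K2.
- by move=> i lt_i; rewrite mxeval_addC K1 ann.
- move=> i lt_i; rewrite monicE lead_coef_comp ?size_XsubC //.
  by rewrite lead_coefXsubC expr1n mulr1; apply: mon.
- move=> i j lt_ij; have [g ->] := chain i j lt_ij.
  by exists (g \Po ('X - c%:P)); rewrite comp_polyM.
Qed.

(** * Lifting unimodular rows *)

Lemma dvdz_rowP n (q : int) (u : 'rV[int]_n) :
  (exists w, u = q *: w) <-> (forall j, (q %| u 0%R j)%Z).
Proof.
split=> [[w ->] j|qu]; first by rewrite mxE dvdz_mulr.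
exists (\row_j (u 0%R j %/ q)%Z); apply/rowP => j.
by rewrite !mxE mulrC divzK.
Qed.

(** The Smith form of a single row has at most one nonzero entry, the gcd up to sign. *)
Lemma int_row_reduce k (e : 'rV[int]_k.+1) :
  exists2 G : 'M[int]_k.+1, G \in unitmx & exists g : int, e = g *: delta_mx 0 0 *m G.
Proof.
have [L _ [G uG [d _ ->]]] := int_Smith_normal_form e.
exists G => //; exists (L 0 0 * d`_0); congr (_ *m G).
apply/rowP => j; rewrite mxE big_ord1 !mxE !ord1 /= eq_sym.
by rewrite mulr_natr mulrnAr.
Qed.

(** The units modulo a divisor of 3 are the classes of 1 and -1. *)
Lemma dvdz3_lift_unit (d e : int) : (d %| 3)%Z ->
  (forall q, (q %| d)%Z -> (q %| e)%Z -> (q %| 1)%Z) ->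
  exists z, e + d * z \is a GRing.unit.
Proof.
move=> d3 cop.
have Hd : (d == 1) || (d == -1) || (d == 3) || (d == -3).
  move: d3 (dvdn_leq (isT : 0 < 3)%N d3); rewrite /dvdz /=.
  by case: d {cop} => [[|[|[|[|n]]]]|[|[|[|n]]]].
have [z Hz] : exists z, e + d * z = 1 \/ e + d * z = -1.
  have [|n3] := boolP (3 %| e)%Z.
    move=> e3; have [d1|[d1|d3']] : d = 1 \/ d = -1 \/ (3 %| d)%Z.
    - by case/orP: Hd => [/orP[/orP[]|]|] /eqP ->; auto.
    - by exists (1 - e); lia.
    - by exists (e - 1); lia.
    - by have := cop _ d3' e3.
  have [m Hm] : exists m, e = 3 * m + 1 \/ e = 3 * m - 1.
    have H := divz_eq e 3; have := modz_ge0 e (isT : 3 != 0 :> int).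
    have := ltz_mod e (isT : 3 != 0 :> int).
    have : (e %% 3)%Z != 0 by apply: contra n3 => /eqP/dvdz_mod0P.
    move=> r0 r3 r1; have [E|E] : (e %% 3)%Z = 1 \/ (e %% 3)%Z = 2 by lia.
      by exists (e %/ 3)%Z; lia.
    by exists ((e %/ 3)%Z + 1); lia.
  case/orP: Hd => [/orP[/orP[]|]|] /eqP ->.
  - by exists (1 - e); lia.
  - by exists (e - 1); lia.
  - by exists (- m); lia.
  - by exists m; lia.
by exists z; case: Hz => ->; rewrite ?unitr1 // unitrN unitr1.
Qed.

(* Row [i] of [E] only matters modulo [d i].  Clearing the rows one at a time, a primitive
   representative always exists except in the last step, where a single unit modulo
   [d k.-1] remains; for [d k.-1] dividing 3 it lifts to a unit of Z. *)
Lemma unimodular_lift k (d : nat -> int) (E : 'M[int]_k) :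
  let Dg := diag_mx (\row_(i < k) d i) in
  (forall i j, (i <= j < k)%N -> (d j %| d i)%Z) ->
  (forall q (c : 'rV[int]_k), (exists w, c *m Dg = q *: w) ->
     (exists w, c *m E = q *: w) -> exists w, c = q *: w) ->
  ((0 < k)%N -> (d k.-1 %| 3)%Z) ->
  exists Z : 'M[int]_k, E + Dg *m Z \in unitmx.
Proof.
elim: k => [|[|k] IH] in d E *; move=> Dg chain prim last.
- by exists 0; rewrite unitmxE det_mx00 unitr1.
- have [q qd qe|z Hz] := @dvdz3_lift_unit (d 0%N) (E 0 0) (last isT).
    have [w w1] : exists w, 1%:M = q *: w :> 'rV_1.
      apply: prim; rewrite mul1mx; apply/dvdz_rowP => j.
        by rewrite !mxE !ord1 eqxx.
      by rewrite ord1.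
    by have /dvdz_rowP/(_ 0) : exists w, 1%:M = q *: w :> 'rV_1;
      [exists w | rewrite mxE].
  exists z%:M; rewrite unitmxE det_mx11.
  by rewrite mul_mx_scalar !mxE !eqxx mulr1n mulrC.
(* The column operation [G] turns row 0 into (h, 0, ..., 0), and the freedom modulo [d 0] makes it
   (h, d 0, 0, ..., 0). Its gcd [g] is a unit by primitivity, and [G2] brings the row to (g, 0, ...,
   0). *)
have [G uG [h Eh]] := int_row_reduce (row 0 E).
pose E1 := E *m invmx G; pose E2 := E1 + Dg *m delta_mx 0 1.
have [G2 uG2 [g Eg]] := int_row_reduce (row 0 E2).
have rE1 : row 0 E1 = h *: delta_mx 0 0 by rewrite row_mul Eh mulmxK.
have rE2 : row 0 E2 = h *: delta_mx 0 0 + d 0%N *: delta_mx 0 1.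
  rewrite raddfD /= rE1; congr (_ + _); apply/rowP => j.
  rewrite mxE mul_diag_mx !mxE.
  by rewrite eqxx.
have gE2 j : (g %| row 0%R E2 0%R j)%Z.
  by rewrite Eg -scalemxAl mxE dvdz_mulr.
have gh : (g %| h)%Z by move: (gE2 0); rewrite rE2 !mxE /= !mulr1 mulr0 addr0.
have gd : (g %| d 0%N)%Z by move: (gE2 1); rewrite rE2 !mxE /= !mulr1 mulr0 add0r.
have g1 : (g %| 1)%Z.
  have /dvdz_rowP/(_ 0) : exists w, delta_mx 0 0 = g *: w :> 'rV_k.+2.
    apply: prim; apply/dvdz_rowP => j.
      rewrite -rowE /Dg mxE mxE mxE.
      by case: eqP => _; rewrite ?mulr1n ?mulr0n ?dvdz0.
    by rewrite -rowE Eh -scalemxAl mxE dvdz_mulr.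
  by rewrite mxE.
have gg : g * g = 1.
  have : `|g|%N = 1%N by move: g1; rewrite dvdzE /= dvdn1 => /eqP.
  by lia.
have [E3 E3def] : exists E3 : 'M[int]_(1 + k.+1), E3 = E2 *m invmx G2 by eexists.
have rE3 : row 0 E3 = g *: delta_mx 0 0 by rewrite E3def row_mul Eg mulmxK.
pose cl := dlsubmx E3; pose E4 := drsubmx E3.
have E3E : E3 = block_mx g%:M 0 cl E4.
  rewrite -[LHS]submxK; congr block_mx; apply/matrixP => i j.
    rewrite !ord1 !mxE eqxx mulr1n.
    have <- : row 0 E3 0 0 = g by rewrite rE3 !mxE mulr1.
    by rewrite mxE; congr (E3 _ _); apply/val_inj.
  rewrite !ord1 !mxE.
  have <- : row 0 E3 0 (rshift 1 j) = 0 by rewrite rE3 !mxE mulr0.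
  by rewrite mxE; congr (E3 _ _); apply/val_inj.
have [||| Z4 uZ4] := IH (fun i => d i.+1) E4.
- by move=> i j ij; apply: chain.
- move=> q c' [w1 Hw1] /= [w2 Hw2].
  (* Since [g * g = 1], this choice makes the first entry of [c *m E3] vanish. *)
  pose c0 : 'rV[int]_1 := - g *: (c' *m cl).
  pose c : 'rV[int]_(1 + k.+1) := row_mx c0 c'.
  have qc' j : (q %| (c' 0 j * d j.+1)%R)%Z.
    have /dvdz_rowP/(_ j) : exists w, c' *m diag_mx (\row_(i < k.+1) d i.+1) = q *: w.
      by exists w1.
    by rewrite mul_mx_diag !mxE.
  (* [d 0] is a multiple of every [d j.+1], so divisibility passes from [c'] to [c0]. *)
  have qc0 : (q %| (c0 0 0 * d 0%N)%R)%Z.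
    rewrite !mxE -mulrA mulr_suml; apply: dvdz_mull; apply: rpred_sum => j _.
    have /dvdzP[m ->] := chain 0%N j.+1 (ltn_ord j).
    have -> : c' 0 j * cl j 0 * (m * d j.+1) = cl j 0 * m * (c' 0 j * d j.+1) by ring.
    exact: dvdz_mull.
  have cDg : exists w, c *m Dg = q *: w.
    apply/dvdz_rowP => j; rewrite mul_mx_diag mxE [in X in _ * X]mxE.
    case: (@splitP 1 k.+1 j) => j' Ej.
      have -> : j = lshift k.+1 j' by apply/val_inj.
      by rewrite row_mxEl ord1.
    have -> : j = rshift 1 j' by apply/val_inj.
    by rewrite row_mxEr; apply: qc'.
  pose w2' : 'rV[int]_k.+2 := (row_mx (0 : 'rV_1) w2 : 'rV_(1 + k.+1)).
  have cE3 : c *m E3 = q *: w2'.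
    transitivity (q *: (row_mx (0 : 'rV_1) w2 : 'rV_(1 + k.+1))) => //.
    rewrite E3E mul_row_block mulmx0 add0r Hw2 scale_row_mx scaler0.
    by rewrite /c0 mul_mx_scalar scalerA mulrN gg scaleN1r addNr.
  have cE2 : c *m E2 = q *: (w2' *m G2).
    by rewrite scalemxAl -cE3 E3def -mulmxA mulmxKV.
  have [w3 Ew3] := cDg.
  (* Going back from [E2] to [E1] costs [c *m Dg *m delta_mx 0 1], again a multiple of [q]. *)
  have cE1 : c *m E1 = q *: (w2' *m G2 - w3 *m delta_mx 0 1).
    rewrite scalerBr -cE2 [q *: (w3 *m _)]scalemxAl -Ew3.
    have -> : c *m E2 = c *m E1 + c *m Dg *m delta_mx 0 1.
      by rewrite -[in RHS](mulmxA c Dg) -mulmxDr.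
    exact/esym/addrK.
  have [||w Ew] := prim q c; first by exists w3.
    exists ((w2' *m G2 - w3 *m delta_mx 0 1) *m G).
    by rewrite scalemxAl -cE1 -mulmxA mulmxKV.
  by exists (rsubmx (w : 'rV_(1 + k.+1))); rewrite -linearZ /= -Ew row_mxKr.
- by move=> _; apply: last.
(* The witness combines the correction of the lower right block with the one made in row 0, carried
   back through [G2] and [G]. *)
pose Z' : 'M[int]_(1 + k.+1) := block_mx 0 0 0 Z4.
exists ((Z' *m G2 + delta_mx 0 1) *m G).
have -> : E + Dg *m ((Z' *m G2 + delta_mx 0 1) *m G) = (E3 + Dg *m Z') *m G2 *m G.
  have E3G : E3 *m G2 = E2 by rewrite E3def mulmxKV.
  have E2G : E2 *m G = E + Dg *m delta_mx 0 1 *m G by rewrite mulmxDl /E1 mulmxKV.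
  rewrite (mulmxDl E3) E3G (mulmxDl E2) E2G (mulmxDl (Z' *m G2)) mulmxDr !mulmxA.
  by rewrite addrAC addrA.
rewrite !unitmx_mul uG uG2 !andbT.
have -> : Dg *m Z' = (block_mx (0 : 'M_1) 0 0
                       (diag_mx (\row_(i < k.+1) d i.+1) *m Z4) : 'M_(1 + k.+1)).
  have -> : Dg = (block_mx ((d 0%N)%:M : 'M_1) 0 0
                    (diag_mx (\row_(i < k.+1) d i.+1)) : 'M_(1 + k.+1)).
    apply/matrixP => i j; rewrite mxE [RHS]mxE.
    case: (@splitP 1 k.+1 i) => i' Ei; rewrite [RHS]mxE; case: (@splitP 1 k.+1 j) => j' Ej;
      rewrite !mxE -!val_eqE /= ?Ei ?Ej ?ord1 //= ?eqxx ?mulr0n ?mulr1n //.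
  by rewrite [LHS](@mulmx_block _ 1 k.+1 1 k.+1 1 k.+1) !mul0mx !mulmx0 !add0r.
rewrite E3E add_block_mx !addr0 unitmxE (@det_lblock _ 1 k.+1) det_scalar1 unitrM.
rewrite -(unitmxE (E4 + _)) uZ4 andbT.
by apply/unitrPr; exists g.
Qed.

(** In the Smith form D = L T R the section forces nonzero diagonal entries, so u is in the kernel
    exactly when the first M entries of u L vanish. The last k rows of the inverse of L are then a
    basis, and the last k columns of L give the coordinates. *)
Lemma ker_basis M k N (D : 'M[int]_(N, M)) (X : 'M[int]_(M, N)) :
  N = (M + k)%N -> X *m D = 1%:M ->
  exists (K : 'M[int]_(k, N)) (K' : 'M[int]_(N, k)),
    [/\ K *m D = 0, K *m K' = 1%:M
      & forall u : 'rV[int]_N, u *m D = 0 -> u = u *m K' *m K].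
Proof.
move=> EN; subst N => XD.
have [L uL [R uR [d _ ED]]] := int_Smith_normal_form D.
set T := \matrix_(i, j) _ in ED.
pose dg := diag_mx (\row_(i < M) d`_i).
have ET : T = col_mx dg 0.
  apply/matrixP => i j; rewrite mxE mxE; case: (splitP i) => i' Ei; rewrite !mxE Ei //.
  have -> : (M + i' == j)%N = false by have := ltn_ord j; lia.
  by [].
have dP i : (i < M)%N -> d`_i != 0.
  move=> lt_i; have H : R *m X *m L *m T = 1%:M.
    have /mulmx1C : X *m L *m T *m R = 1%:M by rewrite -XD ED !mulmxA.
    by rewrite !mulmxA.
  apply/eqP => di0; move/matrixP/(_ (Ordinal lt_i) (Ordinal lt_i)): H.
  rewrite !mxE eqxx big1 // => j _; rewrite [T _ _]mxE /=.
  by case: eqP => [->|_]; rewrite ?di0 ?mul0rn ?mulr0n mulr0.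
exists (dsubmx (invmx L)), (rsubmx L); split.
- rewrite ED ET mul_dsub_mx -!mulmxA [invmx L *m _]mulmxA mulVmx // mul1mx.
  by rewrite mul_col_mx col_mxKd mul0mx.
- rewrite mulmx_rsub mul_dsub_mx mulVmx // (scalar_mx_block M k) -[rsubmx _]/(drsubmx _).
  exact: block_mxKdr.
move=> u; rewrite ED !mulmxA => /(canRL (mulmxK uR)); rewrite mul0mx => uLT.
have l0 : lsubmx (u *m L) = 0.
  move: uLT; rewrite -{1}[u *m L]hsubmxK ET mul_row_col mulmx0 addr0.
  move/rowP => H; apply/rowP => j; move/(_ j): H.
  rewrite mul_mx_diag !mxE => /eqP; rewrite mulf_eq0 (negPf (dP _ _)) // orbF.
  by move/eqP.
rewrite -[u in LHS](mulmxK uL) -[u *m L]hsubmxK l0 mulmx_rsub.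
by rewrite -[invmx L in LHS]vsubmxK mul_row_col mul0mx add0r.
Qed.

Lemma mulmx_mxeval_ker m N (K : 'M[int]_(m, N)) (B : 'M[int]_N) f :
  K *m B = 0 -> K *m mxeval B f = f.[0] *: K.
Proof.
move=> KB; elim/poly_ind: f => [|f c IH].
  by rewrite mxeval0 mulmx0 horner0 scale0r.
rewrite mxevalD mxevalM mxevalX mxevalC mulmxDr mulmxA IH -scalemxAl KB scaler0 add0r.
by rewrite mul_mx_scalar !hornerE.
Qed.

Lemma poly_drop1 (a : {poly int}) : a = a.[0]%:P + 'X * drop_poly 1 a.
Proof.
apply/polyP => [[|i]]; rewrite coefD coefC coefXM coef_drop_poly /=.
  by rewrite addr0 horner_coef0.
by rewrite add0r addn1.
Qed.

(** With f reduced modulo a, the multiple of a has smaller degree than a and is zero; comparing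
    coefficients at the degree of [drop_poly 1 a], which is monic, shows that q divides c. If a = 1
    then [drop_poly 1 a] is 0, and the last hypothesis gives the claim. *)
Lemma dvdz_coef_drop (a f : {poly int}) (c q : int) : a \is monic ->
  pdvd a (c *: drop_poly 1 a - q *: f) -> (q %| (c * a.[0])%R)%Z -> (q %| c)%Z.
Proof.
move=> ma; have [sz1|sz] := leqP (size a) 1.
  by rewrite (monic_size_le1 ma sz1) hornerC mulr1.
move=> [g Eg] _.
have [n szn] : exists n, size a = n.+2.
  by case: (size a) sz => [|[|n]] // _; exists n.
pose f' := Pdiv.Ring.rmodp f a.
have Ef : f = Pdiv.Ring.rdivp f a * a + f' by apply: Pdiv.RingMonic.rdivp_eq.
have szf' : (size f' < size a)%N by rewrite Pdiv.Ring.ltn_rmodpN0 // monic_neq0.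
pose h := c *: drop_poly 1 a - q *: f'.
have hE : h = (g + q *: Pdiv.Ring.rdivp f a) * a.
  have E : q *: f = q *: (Pdiv.Ring.rdivp f a * a) + q *: f' by rewrite -scalerDr -Ef.
  by rewrite mulrDl -Eg E -scalerAl opprD addrA [RHS]addrAC subrK.
have szh : (size h < size a)%N.
  rewrite szn ltnS; apply: leq_trans (size_polyD _ _) _.
  rewrite geq_max size_polyN; apply/andP; split.
    by apply: leq_trans (size_scale_leq _ _) _; rewrite size_drop_poly szn subn1.
  by apply: leq_trans (size_scale_leq _ _) _; rewrite -ltnS -szn.
have h0 : h = 0 by apply: pdvd_small szh; eexists; apply: hE.
have : h`_n = 0 by rewrite h0 coef0.
rewrite coefB !coefZ coef_drop_poly addn1.
have -> : a`_n.+1 = 1 by move/monicP: ma; rewrite lead_coefE szn.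
by rewrite mulr1 => /eqP; rewrite subr_eq0 => /eqP ->; rewrite dvdz_mulr.
Qed.

(** * Extensions by a kernel *)

Section TopIndices.
Variables (s k : nat).

(* The indices are reversed because [unimodular_lift] wants the largest modulus first. *)
Definition top T (x : 'I_k -> T) (dflt : T) (i : nat) : T :=
  if insub (i - s)%N is Some j then x (rev_ord j) else dflt.

Lemma topE T (x : 'I_k -> T) dflt t : top x dflt (s + rev_ord t)%N = x t.
Proof. by rewrite /top addKn valK rev_ordK. Qed.

Lemma sum_top (V : zmodType) (F : nat -> V) :
  \sum_(i < s + k) F i = \sum_(i < s) F i + \sum_(t < k) F (s + rev_ord t)%N.
Proof.
by rewrite big_split_ord /= [in X in _ + X = _](reindex_inj rev_ord_inj).
Qed.

Lemma top_ind i : (s <= i < s + k)%N -> exists t : 'I_k, i = (s + rev_ord t)%N.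
Proof.
move=> /andP[le_si lt_i]; have lt : (i - s < k)%N by lia.
by exists (rev_ord (Ordinal lt)); rewrite rev_ordK /= subnKC.
Qed.

Lemma top_lt t : (s + @rev_ord k t < s)%N = false.
Proof. by rewrite ltnNge leq_addr. Qed.

Lemma top_lt_add t : (s + @rev_ord k t < s + k)%N.
Proof. by rewrite ltn_add2l ltn_ord. Qed.

End TopIndices.

Lemma row_diag_mul (R : pzRingType) m n (d : 'rV[R]_m) (Z : 'M[R]_(m, n)) i :
  row i (diag_mx d *m Z) = d 0 i *: row i Z.
Proof. by rewrite row_mul row_diag_mx -scalemxAl -rowE. Qed.

Section Extension.
Variables (M k N s : nat) (D : 'M[int]_(N, M)) (U : 'M[int]_(M, N)).
Variables (X : 'M[int]_(M, N)) (Y : 'M[int]_(N, M)).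
Variables (v : nat -> 'rV[int]_M) (a : nat -> {poly int}).
Hypotheses (EN : N = (M + k)%N) (XD : X *m D = 1%:M) (UY : U *m Y = 1%:M).
Hypothesis dec : cyclic_decomp (U *m D) (s + k) v a.
Hypothesis a_low : forall i, (i < s)%N -> (a i).[0] * (a i).[0] = 1.
Hypothesis a_top : (0 < k)%N -> ((a s).[0] %| 3)%Z.

Local Notation A := (U *m D).
Local Notation B := (D *m U).
Local Notation idx t := (s + @rev_ord k t)%N.

Lemma mxeval_down f : mxeval B f *m D = D *m mxeval A f.
Proof. by apply: mxeval_intertwine; rewrite mulmxA. Qed.

(** [B] acts through [D], and [v i *m X] lifts [v i] along [D], so the part of [a i] divisible by x
    lands in the image of [U]. *)
Lemma lift_relation i :
  v i *m X *m mxeval B (a i) =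
  (a i).[0] *: (v i *m X) + v i *m mxeval A (drop_poly 1 (a i)) *m U.
Proof.
rewrite {1}(poly_drop1 (a i)) mxevalD mxevalC mulmxDr mul_mx_scalar; congr (_ + _).
rewrite mulrC mxevalM mxevalX !mulmxA -[_ *m mxeval B _ *m D]mulmxA mxeval_down.
by rewrite !mulmxA -[v i *m X *m D]mulmxA XD mulmx1.
Qed.

(* The relation [a_i(B) w_i = e_i] reads [e_i = a_i(0) w_i + z_i U], and [U] is split
   injective, so a common prime divisor would divide [\sum_i c_i z_i]. *)
Lemma extension_class_primitive (K : 'M[int]_(k, N)) (K' : 'M[int]_(N, k)) :
  (forall u : 'rV[int]_N, u *m D = 0 -> u = u *m K' *m K) ->
  let E := \matrix_t (v (idx t) *m X *m mxeval B (a (idx t)) *m K') in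
  forall q (c : 'rV[int]_k),
    (exists w, c *m diag_mx (\row_t (a (idx t)).[0]) = q *: w) ->
    (exists w, c *m E = q *: w) -> exists w, c = q *: w.
Proof.
move=> kerK E q c Hd [w2 Hw2]; have [w1 Hw1] := Hd.
have [span indep ann mon chain] := dec.
pose W0 := \matrix_(t < k) (v (idx t) *m X).
pose Z := \matrix_(t < k) (v (idx t) *m mxeval A (drop_poly 1 (a (idx t)))).
have EK : E *m K = diag_mx (\row_t (a (idx t)).[0]) *m W0 + Z *m U.
  apply/row_matrixP => t; rewrite row_mul rowK -kerK; last first.
    rewrite -mulmxA mxeval_down !mulmxA -[v _ *m X *m D]mulmxA XD mulmx1.
    by rewrite ann ?top_lt_add.
  by rewrite lift_relation raddfD /= row_diag_mul row_mul !rowK mxE.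
(* By [EK], [c *m Z *m U] is a multiple of [q]; the retraction [Y] removes [U]. *)
have cZ : c *m Z = q *: ((w2 *m K - w1 *m W0) *m Y).
  rewrite -[LHS]mulmx1 -UY mulmxA -[c *m Z *m U]mulmxA.
  rewrite -[Z *m U](addKr (diag_mx (\row_t (a (idx t)).[0]) *m W0)) -EK.
  rewrite mulmxDr mulmxN !mulmxA Hw1 Hw2 -!scalemxAl -scalerN -scalerDr -scalemxAl.
  by rewrite [- _ + _]addrC.
have [f Ef] := span ((w2 *m K - w1 *m W0) *m Y).
pose cc := top s (fun t => c 0 t) 0.
(* Expanding that multiple of [q] in the generators yields a relation among them, to which [indep]
   applies. *)
have Hdiv i : (i < s + k)%N ->
    pdvd (a i) ((if (i < s)%N then 0 else cc i) *: drop_poly 1 (a i) - q *: f i).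
  move: i; apply: (indep (fun i =>
    (if (i < s)%N then 0 else cc i) *: drop_poly 1 (a i) - q *: f i)).
  under eq_bigr => i _ do rewrite mxevalB !mxevalZ mulmxBr -!scalemxAr.
  rewrite sumrB -scaler_sumr -Ef -cZ.
  rewrite (sum_top s k (fun i => (if (i < s)%N then 0 else cc i) *:
     (v i *m mxeval A (drop_poly 1 (a i))))) big1 ?add0r; last first.
    by move=> i _; rewrite ltn_ord scale0r.
  rewrite mulmx_sum_row; apply/eqP; rewrite subr_eq0; apply/eqP.
  by apply: eq_bigr => t _; rewrite top_lt /cc topE rowK.
apply/dvdz_rowP => t.
have := Hdiv _ (top_lt_add s t); rewrite top_lt /cc topE => Hd1.
apply: dvdz_coef_drop (mon _ (top_lt_add s t)) Hd1 _.
by have /dvdz_rowP/(_ t) := Hd; rewrite mul_mx_diag !mxE.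
Qed.

(** Below [s] the value of [a i] at 0 is a unit, so a lift can be changed by a kernel element until
    [a i] kills it. From [s] on, the lifts are changed so that [a i] sends them to a basis of the
    kernel; as x acts there as 0, their annihilators gain a factor x. *)
Lemma cyclic_decomp_extension : exists w b, cyclic_decomp B (s + k) w b.
Proof.
have [span indep ann mon chain] := dec.
have [K [K' [KD KK kerK]]] := ker_basis EN XD.
have KB : K *m B = 0 by rewrite mulmxA KD mul0mx.
have KE (x : 'rV[int]_k) f : x *m K *m mxeval B f = f.[0] *: (x *m K).
  by rewrite -mulmxA mulmx_mxeval_ker // -scalemxAr.
pose w0 i := v i *m X; pose eps i := w0 i *m mxeval B (a i) *m K'.
have w0D i : w0 i *m D = v i by rewrite /w0 -mulmxA XD mulmx1.
have epsK i : (i < s + k)%N -> eps i *m K = w0 i *m mxeval B (a i).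
  by move=> lt_i; rewrite -kerK // -mulmxA mxeval_down mulmxA w0D ann.
pose E := \matrix_(t < k) eps (idx t).
pose Dg := diag_mx (\row_(t < k) (a (idx t)).[0]).
have [Z uE] : exists Z : 'M[int]_k, E + Dg *m Z \in unitmx.
  apply: (@unimodular_lift k (fun i => (a (s + (k - i.+1))%N).[0])).
  - move=> i j ij; have [|g ->] := chain (s + (k - j.+1))%N (s + (k - i.+1))%N.
      by lia.
    by rewrite hornerM dvdz_mull.
  - exact: (extension_class_primitive kerK).
  - by move=> k_gt0; rewrite prednK // subnn addn0; apply: a_top.
set E' := E + Dg *m Z in uE.
pose w i := w0 i + (if (i < s)%N then - (a i).[0] *: eps i
                    else top s (fun t => row t Z) 0 i) *m K.
pose b i := if (i < s)%N then a i else a i * 'X.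
have wD i : w i *m D = v i by rewrite mulmxDl w0D -mulmxA KD mulmx0 addr0.
have w_low i : (i < s)%N -> w i *m mxeval B (a i) = 0.
  move=> lt_i; rewrite /w lt_i mulmxDl KE -scalemxAl.
  rewrite epsK; last by apply: leq_trans lt_i (leq_addr _ _).
  by rewrite scalerA mulrN a_low // scaleN1r subrr.
have w_top t : w (idx t) *m mxeval B (a (idx t)) = row t E' *m K.
  rewrite /w top_lt topE mulmxDl KE.
  rewrite raddfD /= row_diag_mul rowK mxE mulmxDl epsK ?top_lt_add //.
  by rewrite -scalemxAl.
exists w, b; split.
- move=> m; have [f Ef] := span (m *m D).
  pose u := m - \sum_(i < s + k) w i *m mxeval B (f i).
  have uD : u *m D = 0.
    rewrite mulmxBl mulmx_suml Ef; apply/eqP; rewrite subr_eq0; apply/eqP.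
    by apply: eq_bigr => i _; rewrite -mulmxA mxeval_down mulmxA wD.
  (* [c] holds the coordinates of the kernel element [u] in the basis [E' *m K], whose rows are the
     images of the top [w i] under [a i]; adding constant multiples of [a i] to [f i] absorbs
     [u]. *)
  pose c := u *m K' *m invmx E'.
  pose h i := if (i < s)%N then 0 else a i * (top s (fun t => c 0 t) 0 i)%:P.
  exists (fun i => f i + h i).
  under eq_bigr => i _ do rewrite mxevalD mulmxDr.
  rewrite big_split /= (sum_top s k (fun i => w i *m mxeval B (h i))).
  rewrite [\sum_(i < s) _]big1 ?add0r; last first.
    by move=> i _; rewrite /h ltn_ord mxeval0 mulmx0.
  apply/eqP; rewrite addrC -subr_eq; apply/eqP; rewrite -/u (kerK u uD).
  rewrite -(mulmxKV uE (u *m K')) -/c -mulmxA mulmx_sum_row.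
  apply: eq_bigr => t _; rewrite /h top_lt topE mxevalM mulmxA w_top row_mul.
  by rewrite mxevalC mul_mx_scalar.
- move=> f f0.
  have Hf i : (i < s + k)%N -> f i = Pdiv.Ring.rdivp (f i) (a i) * a i.
    move=> lt_i; have [|g ->] := indep f _ i lt_i; last first.
      by rewrite Pdiv.RingMonic.rdivp_mull ?mon.
    have := congr1 (mulmx^~ D) f0; rewrite mul0mx mulmx_suml => f0D.
    rewrite -[RHS]f0D; apply: eq_bigr => j _.
    by rewrite -mulmxA mxeval_down mulmxA wD.
  pose g i := Pdiv.Ring.rdivp (f i) (a i).
  (* What remains is a relation inside the kernel, where only the constant terms of the quotients
     [g i] count. They vanish, which gives the extra factor x. *)
  pose c := \row_(t < k) (g (idx t)).[0].
  have c0 : c = 0.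
    rewrite -[c](mulmxK uE) -[c *m E']mulmx1 -KK [c *m E' *m _]mulmxA.
    suff -> : c *m E' *m K = 0 by rewrite !mul0mx.
    rewrite -mulmxA mulmx_sum_row -[RHS]f0.
    rewrite (sum_top s k (fun i => w i *m mxeval B (f i))) [\sum_(i < s) _]big1.
      rewrite add0r; apply: eq_bigr => t _.
      rewrite (Hf _ (top_lt_add s t)) -/(g _) mulrC mxevalM mulmxA w_top row_mul.
      by rewrite KE mxE.
    move=> i _; rewrite Hf; last exact: leq_trans (ltn_ord i) (leq_addr _ _).
    by rewrite mulrC mxevalM mulmxA w_low ?mul0mx.
  move=> i lt_i; rewrite /b; case: ltnP => [lt_is|le_si].
    by exists (g i); rewrite -Hf.
  have [t Et] : exists t : 'I_k, i = idx t by apply: top_ind; rewrite le_si.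
  exists (drop_poly 1 (g i)); rewrite {1}Hf // -/(g i) {1}(poly_drop1 (g i)).
  have -> : (g i).[0] = 0 by have /rowP/(_ t) := c0; rewrite !mxE -Et.
  by rewrite add0r; ring.
- move=> i lt_i; rewrite /b; case: ltnP => [lt_is|le_si]; first exact: w_low.
  have [t Et] : exists t : 'I_k, i = idx t by apply: top_ind; rewrite le_si.
  by rewrite mxevalM mxevalX mulmxA Et w_top -mulmxA KB mulmx0.
- move=> i lt_i; rewrite /b; case: ltnP => _; first exact: mon.
  by rewrite monicMl ?monicX ?mon.
- move=> i j ij; have [h Eh] := chain i j ij; rewrite /b.
  case: (ltnP i s) => [_|le_si].
    case: ifP => _; first by exists h.
    by exists (h * 'X); rewrite Eh; ring.
  have -> : (j < s)%N = false by lia.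
  by exists h; rewrite Eh; ring.
Qed.

End Extension.

(** * Ranks and roots *)

Notation ratmx := (map_mx (intr : int -> rat)).

Lemma map_intr_inj m n : injective (ratmx : 'M[int]_(m, n) -> _).
Proof.
move=> A B /matrixP AB; apply/matrixP => i j.
by have := AB i j; rewrite !mxE => /intr_inj.
Qed.

Lemma row_free_ratmx m n (y : 'M[int]_(m, n)) :
  (forall c : 'rV[int]_m, c *m y = 0 -> c = 0) -> row_free (ratmx y).
Proof.
move=> indep; apply: inj_row_free => c cy.
(* The row is read as a polynomial in order to clear denominators. *)
have [q [a nz_a Eq]] := rat_poly_scale (rVpoly c).
have Ec : c = a%:~R^-1 *: ratmx (poly_rV q).
  apply/rowP => i; have /polyP/(_ i) := Eq.
  by rewrite coef_rVpoly_ord coefZ coef_map !mxE.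
have qy : poly_rV q *m y = 0 :> 'rV_n.
  apply: map_intr_inj; rewrite map_mxM map_mx0.
  have := cy; rewrite Ec -scalemxAl => /eqP; rewrite scaler_eq0 invr_eq0 intr_eq0.
  by rewrite (negPf nz_a) => /eqP.
by rewrite Ec (indep _ qy) map_mx0 scaler0.
Qed.

Lemma indep_rows_rank m n n' (y : 'M[int]_(m, n)) (T : 'M[int]_(n, n')) :
  (forall c : 'rV[int]_m, c *m y = 0 -> c = 0) -> y *m T = 0 ->
  (m + \rank (ratmx T) <= n)%N.
Proof.
move=> /row_free_ratmx/eqP rk yT; rewrite -[X in (X + _)%N]rk; apply: mulmx0_rank_max.
by rewrite -map_mxM yT map_mx0.
Qed.

Lemma Fp_intr_eq0 q (x : int) : prime q ->
  (x%:~R == 0 :> 'F_q) = (q%:Z %| x)%Z.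
Proof.
move=> pr_q; rewrite dvdzE /= (dvdn_pcharf (pchar_Fp pr_q)) {1}(intEsign x).
by rewrite rmorphM rmorph_sign mulrI_eq0 //; apply: lreg_sign.
Qed.

(** Descent: an integral relation vanishes modulo q, so it can be divided by q indefinitely, and
    only zero is divisible by all powers of q. *)
Lemma row_free_Fp q m n (y : 'M[int]_(m, n)) : prime q ->
  row_free (map_mx (intr : int -> 'F_q) y) ->
  forall c : 'rV[int]_m, c *m y = 0 -> c = 0.
Proof.
move=> pr_q free.
have step (c : 'rV[int]_m) : c *m y = 0 -> exists c', c = q%:Z *: c'.
  move=> cy; apply/dvdz_rowP => j.
  have : map_mx (intr : int -> 'F_q) c = 0.
    by apply: (row_free_inj free); rewrite -map_mxM cy map_mx0 mul0mx.
  by move/rowP/(_ j); rewrite !mxE => /eqP; rewrite Fp_intr_eq0.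
have pow e : forall c : 'rV[int]_m, c *m y = 0 -> exists c', c = (q%:Z ^+ e) *: c'.
  elim: e => [|e IH] c cy; first by exists c; rewrite scale1r.
  have [c' Ec] := step c cy; have [|c'' Ec'] := IH c'.
    move/eqP: cy; rewrite Ec -scalemxAl scalemx_eq0 => /orP[|/eqP //].
    by have := prime_gt0 pr_q; case: (q).
  by exists c''; rewrite Ec Ec' scalerA -exprS.
move=> c cy; apply/rowP => j; rewrite mxE; apply/eqP; apply: contraT => nz.
have /dvdz_rowP/(_ j) := pow `|c 0%R j|%N c cy.
rewrite dvdzE abszX /= => /dvdn_leq; rewrite absz_gt0 => /(_ nz).
by rewrite leqNgt ltn_expl // prime_gt1.
Qed.

(** A maximal set of rows independent modulo q stays independent over the rationals. *)
Lemma rank_Fp_le_rat q m n (T : 'M[int]_(m, n)) : prime q ->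
  (\rank (map_mx (intr : int -> 'F_q) T) <= \rank (ratmx T))%N.
Proof.
move=> pr_q; set TF := map_mx _ T.
pose y := rowsub (maxrankfun TF) T.
have /(row_free_Fp pr_q)/row_free_ratmx : row_free (map_mx (intr : int -> 'F_q) y).
  by rewrite map_mxsub; apply: maxrowsub_free.
move=> /eqP <-.
by rewrite /y map_mxsub; apply/mxrankS/rowsub_sub.
Qed.

(** An equality of nullities: for nonzero [c], multiplication by [X] embeds the [c]-eigenspace of
    [X *m Y] into that of [Y *m X], and symmetrically. *)
Lemma rank_mulC_sub_scalar (F : fieldType) a b (X : 'M[F]_(a, b)) (Y : 'M[F]_(b, a)) c :
  c != 0 -> (\rank (X *m Y - c%:M)%R + b = \rank (Y *m X - c%:M)%R + a)%N.
Proof.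
move=> nz.
have H a' b' (X' : 'M[F]_(a', b')) (Y' : 'M[F]_(b', a')) :
    (\rank (kermx (X' *m Y' - c%:M)%R) <= \rank (kermx (Y' *m X' - c%:M)%R))%N.
  set K := kermx _; have KXY : K *m X' *m Y' = c *: K.
    apply/eqP; rewrite -subr_eq0 -mul_mx_scalar -mulmxA -mulmxBr.
    by rewrite mulmx_ker.
  have : (K *m X' <= kermx (Y' *m X' - c%:M))%MS.
    by apply/sub_kermxP; rewrite mulmxBr mulmxA KXY mul_mx_scalar -scalemxAl subrr.
  move/mxrankS; apply: leq_trans.
  have -> : \rank K = \rank (c *: K) by rewrite mxrank_scale_nz.
  by rewrite -KXY mxrankM_maxl.
have := H _ _ X Y; have := H _ _ Y X; rewrite !mxrank_ker.
have := rank_leq_row (X *m Y - c%:M); have := rank_leq_row (Y *m X - c%:M).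
lia.
Qed.

Lemma monic_dvd_prod_XsubC (a : {poly int}) (cs : seq int) : a \is monic ->
  pdvd a (\prod_(c <- cs) ('X - c%:P)) ->
  exists m, a = \prod_(c <- mask m cs) ('X - c%:P).
Proof.
move=> ma [g Eg].
have /(@dvdp_prod_XsubC _ _ _ id)[m] : a %| \prod_(c <- cs) ('X - c%:P).
  by rewrite Eg dvdp_mulIr.
by rewrite eqp_monic ?monic_prod_XsubC // => /eqP ->; exists m.
Qed.

(** As [a s] divides the later [a i], each of these is some g_i times x - c. The vectors v_i g_i(A)
    are killed by A - c, and they are independent because g_i has smaller degree than a_i. *)
Lemma root_count N (A : 'M[int]_N) s k v a (c : int) :
  cyclic_decomp A (s + k) v a -> (0 < k)%N -> root (a s) c ->
  (k + \rank (ratmx (A - c%:M)%R) <= N)%N.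
Proof.
move=> [span indep ann mon chain] k_gt0 rc.
pose g i := Pdiv.Ring.rdivp (a i) ('X - c%:P).
have Eg i : (s <= i < s + k)%N -> a i = g i * ('X - c%:P).
  move=> ij; rewrite Pdiv.RingMonic.rdivpK ?monicXsubC //.
  have [h ->] := chain s i ij.
  have /factor_theorem[h' ->] := rc.
  by rewrite mulrA Pdiv.RingMonic.rdvdp_mull ?monicXsubC.
pose y := \matrix_(t < k) (v (s + rev_ord t)%N *m mxeval A (g (s + rev_ord t)%N)).
have idx_in (t : 'I_k) : (s <= s + rev_ord t < s + k)%N.
  by rewrite leq_addr top_lt_add.
apply: (@indep_rows_rank _ _ _ y); last first.
  apply/row_matrixP => t; rewrite row_mul rowK row0 -mulmxA.
  have -> : mxeval A (g (s + rev_ord t)%N) *m (A - c%:M) = mxeval A (a (s + rev_ord t)%N).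
    by rewrite Eg // mxevalM mxevalB mxevalX mxevalC.
  by rewrite ann ?top_lt_add.
move=> d dy; pose cc i := if (i < s)%N then 0 else top s (fun t => d 0 t) 0 i.
have Hdiv i : (i < s + k)%N -> pdvd (a i) (cc i *: g i).
  move: i; apply: (indep (fun i => cc i *: g i)).
  rewrite (sum_top s k (fun i => v i *m mxeval A (cc i *: g i))) big1 ?add0r.
    rewrite -[RHS]dy mulmx_sum_row; apply: eq_bigr => t _.
    by rewrite rowK /cc top_lt topE mxevalZ scalemxAr.
  by move=> i _; rewrite /cc ltn_ord scale0r mxeval0 mulmx0.
apply/rowP => t; rewrite mxE; apply/eqP; apply: contraT => nz.
have mg : g (s + rev_ord t)%N \is monic.
  by have := mon _ (top_lt_add s t); rewrite {1}Eg // monicMr ?monicXsubC.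
have := Hdiv _ (top_lt_add s t); rewrite /cc top_lt topE => /size_pdvd.
rewrite scale_poly_eq0 negb_or nz monic_neq0 // => /(_ isT).
rewrite size_scale // Eg // size_Mmonic ?monicXsubC ?monic_neq0 //.
by rewrite size_XsubC addn2 ltnn.
Qed.

(** * Differential posets *)

Section DifferentialPoset.
Variables (r : nat) (p : nat -> nat) (C : forall n, 'I_(p n) -> 'I_(p n.+1) -> bool).
Hypothesis r_gt0 : (0 < r)%N.
Hypothesis diffC : differential C r.
Hypothesis surjD : forall n (w : 'rV[int]_(p n)),
  exists u : 'rV[int]_(p n.+1), u *m Dmx C n = w.

Lemma Umx_tr n : Umx C n = (Dmx C n)^T.
Proof. by apply/matrixP => i j; rewrite !mxE. Qed.

Lemma sum_bool_card (T : finType) (P : pred T) :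
  \sum_(i : T) (P i : nat)%:Z = #|[set i | P i]|%:Z :> int.
Proof.
under eq_bigr => i _ do rewrite -natz.
rewrite -natr_sum natz -sum1dep_card [in RHS]big_mkcond /=.
by congr Posz; apply: eq_bigr => i _; case: (P i).
Qed.

Lemma DUmxE n (x y : 'I_(p n)) : DUmx C n x y = (ncommon_up C x y)%:Z.
Proof.
rewrite mxE /ncommon_up -sum_bool_card; apply: eq_bigr => z _.
by rewrite !mxE -PoszM mulnb.
Qed.

Lemma UDmxE n (x y : 'I_(p n.+1)) : (Dmx C n *m Umx C n) x y = (ncommon_down C x y)%:Z.
Proof.
rewrite mxE /ncommon_down -sum_bool_card; apply: eq_bigr => z _.
by rewrite !mxE -PoszM mulnb.
Qed.

Lemma ncommon_up_diag n (x : 'I_(p n)) : ncommon_up C x x = nup C x.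
Proof. by apply: eq_card => z; rewrite !inE andbb. Qed.

Lemma ncommon_down_diag n (x : 'I_(p n)) : ncommon_down C x x = ndown C x.
Proof. by case: n x => [|n] x //; apply: eq_card => z; rewrite !inE andbb. Qed.

(** (D2) gives the entries off the diagonal, (D3) those on it. *)
Lemma DUmxS n : DUmx C n.+1 = Dmx C n *m Umx C n + (r%:Z)%:M.
Proof.
have [_ _ D2 D3] := diffC; apply/matrixP => x y.
rewrite DUmxE [RHS]mxE UDmxE mxE; have [->|neq] := eqVneq x y; last first.
  by rewrite mulr0n addr0 D2.
by rewrite mulr1n -PoszD ncommon_up_diag ncommon_down_diag D3.
Qed.

Lemma DUmx0 : DUmx C 0 = (r%:Z)%:M.
Proof.
have [p0 _ _ D3] := diffC; apply/matrixP => x y; rewrite DUmxE mxE.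
have lt1 (z : 'I_(p 0)) : (z < 1)%N by apply: leq_trans (ltn_ord z) _; rewrite p0.
have -> : x = y by apply/val_inj; rewrite /=; have := lt1 x; have := lt1 y; lia.
by rewrite eqxx mulr1n ncommon_up_diag D3.
Qed.

Lemma Dmx_section n : exists X : 'M[int]_(p n, p n.+1), X *m Dmx C n = 1%:M.
Proof.
have [X HX] := fin_all_exists (fun i : 'I_(p n) => surjD (row i 1%:M)).
by exists (\matrix_i X i); apply/row_matrixP => i; rewrite row_mul rowK HX.
Qed.

Lemma Umx_retraction n : exists Y : 'M[int]_(p n.+1, p n), Umx C n *m Y = 1%:M.
Proof.
by have [X HX] := Dmx_section n; exists X^T; rewrite Umx_tr -trmx_mul HX trmx1.
Qed.

(** The field is arbitrary because the rank is used over the rationals and modulo primes. *)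
Lemma rank_Dmx (F : fieldType) n : \rank (map_mx (intr : int -> F) (Dmx C n)) = p n.
Proof.
have [X HX] := Dmx_section n; apply/eqP; rewrite eqn_leq rank_leq_col.
have := mxrankM_maxr (map_mx (intr : int -> F) X) (map_mx (intr : int -> F) (Dmx C n)).
by rewrite -map_mxM HX map_mx1 mxrank1.
Qed.

Lemma rank_Umx (F : fieldType) n : \rank (map_mx (intr : int -> F) (Umx C n)) = p n.
Proof. by rewrite Umx_tr -map_trmx mxrank_tr rank_Dmx. Qed.

Lemma leq_rank_size n : (p n <= p n.+1)%N.
Proof. by rewrite -[X in (X <= _)%N](rank_Dmx rat n) rank_leq_row. Qed.

(** This is Delta p_n as a natural number; by [leq_rank_size] the truncated subtraction is exact. *)
Definition rank_diff n := (p n - (if n is m.+1 then p m else 0))%N.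

Lemma rank_diffS n : p n.+1 = (p n + rank_diff n.+1)%N.
Proof. by rewrite /rank_diff subnKC ?leq_rank_size. Qed.

Lemma rank_diffE n : dp p n%:Z = (rank_diff n)%:Z.
Proof.
case: n => [|n]; first by rewrite /dp /= subr0 /rank_diff subn0.
have -> : dp p n.+1%:Z = (p n.+1)%:Z - (p n)%:Z by rewrite /dp (_ : n.+1%:Z - 1 = n) //; lia.
by rewrite rank_diffS; lia.
Qed.

(** Subtracting r turns DU_{n+1} into UD_{n+1}. Its nonzero eigenvalues have the same multiplicities
    as for DU_n, and 0 has multiplicity Delta p_{n+1} since D is onto and U injective. *)
Lemma nullity_DUmx n j : (0 < j <= n.+1)%N ->
  (\rank (ratmx (DUmx C n - ((r * j)%N%:Z)%:M)%R) + rank_diff (n.+1 - j) = p n)%N.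
Proof.
elim: n j => [|n IH] j Hj.
  have -> : j = 1%N by lia.
  by rewrite DUmx0 muln1 subrr map_mx0 mxrank0 /rank_diff subn0.
case: j Hj => [//|j Hj].
have -> : DUmx C n.+1 - ((r * j.+1)%N%:Z)%:M = Dmx C n *m Umx C n - ((r * j)%N%:Z)%:M.
  by rewrite DUmxS mulnS PoszD raddfD /= opprD addrA addrK.
have [->|j_gt0] := posnP j.
  rewrite muln0 raddf0 subr0 subn1 /= map_mxM [RHS]rank_diffS.
  by rewrite mxrankMfree ?rank_Dmx // /row_free rank_Umx.
have nz : ((r * j)%N%:Z)%:~R != 0 :> rat by rewrite intr_eq0; lia.
have -> : ratmx (Dmx C n *m Umx C n - ((r * j)%N%:Z)%:M)
        = ratmx (Dmx C n) *m ratmx (Umx C n) - (((r * j)%N%:Z)%:~R)%:M.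
  by rewrite map_mxB map_mxM map_scalar_mx.
have := rank_mulC_sub_scalar (ratmx (Umx C n)) (ratmx (Dmx C n)) nz.
have -> : (n.+2 - j.+1 = n.+1 - j)%N by lia.
have := IH j.
have -> : ratmx (DUmx C n - ((r * j)%N%:Z)%:M)
        = ratmx (Umx C n) *m ratmx (Dmx C n) - (((r * j)%N%:Z)%:~R)%:M.
  by rewrite map_mxB map_mxM map_scalar_mx.
have -> : (0 < j <= n.+1)%N by lia.
move=> /(_ isT); set x := \rank (ratmx (Umx C n) *m _ - _).
by set y := \rank (ratmx (Dmx C n) *m _ - _); move: x y => x y; lia.
Qed.

(* Modulo a prime [q] dividing [r * j] the matrix of DU agrees with its shift by [r * j],
   while surjectivity of D bounds its nullity by [rank_diff m.+1]. *)
Lemma rank_diff_ge m j : (0 < j <= m.+1)%N -> (r * j)%N != 1%N ->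
  (rank_diff (m.+1 - j) <= rank_diff m.+1)%N.
Proof.
move=> Hj rj1; pose q := pdiv (r * j).
have rj_gt1 : (1 < r * j)%N by case/andP: Hj; lia.
have pr_q : prime q by apply: pdiv_prime.
have H1 := nullity_DUmx Hj.
pose modq := map_mx (intr : int -> 'F_q).
have Eq : modq _ _ (DUmx C m - ((r * j)%N%:Z)%:M) = modq _ _ (DUmx C m).
  rewrite /modq map_mxB map_scalar_mx /=.
  have -> : ((r * j)%N%:Z)%:~R = 0 :> 'F_q.
    by apply/eqP; rewrite Fp_intr_eq0 // dvdzE /= pdiv_dvd.
  by rewrite raddf0 subr0.
have := rank_Fp_le_rat (DUmx C m - ((r * j)%N%:Z)%:M) pr_q.
rewrite -/(modq _ _ _) Eq.
have -> : modq _ _ (DUmx C m) = modq _ _ (Umx C m) *m modq _ _ (Dmx C m).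
  exact: map_mxM.
(* Sylvester's inequality: the rank modulo [q] is at least 2 p_m - p_{m+1}. *)
have := mxrank_mul_min (modq _ _ (Umx C m)) (modq _ _ (Dmx C m)).
have -> : \rank (modq _ _ (Umx C m)) = p m by exact: rank_Umx.
have -> : \rank (modq _ _ (Dmx C m)) = p m by exact: rank_Dmx.
move: H1 (rank_diffS m); set x := \rank (ratmx _).
by set y := \rank (_ *m _); move: x y => x y; lia.
Qed.

(** After the shift by r the factor for j = 1 becomes x, and the other factors form the product for
    the previous rank, which moves past D by intertwining. *)
Lemma DUmx_annihilator n :
  mxeval (DUmx C n) (\prod_(c <- [seq (r * j)%N%:Z | j <- iota 1 n.+1]) ('X - c%:P)) = 0.
Proof.
rewrite big_map; elim: n => [|n IH].
  by rewrite big_seq1 mxevalB mxevalX mxevalC DUmx0 muln1 subrr.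
rewrite DUmxS mxeval_addC.
rewrite -[iota 1 n.+2]/(1%N :: iota (1 + 1) n.+1) big_cons iotaDl big_map.
rewrite comp_polyM comp_polyB comp_polyX comp_polyC muln1 addrK mulrC.
have -> : (\prod_(j <- iota 1 n.+1) ('X - ((r * (1 + j))%N%:Z)%:P)) \Po ('X + (r%:Z)%:P)
        = \prod_(j <- iota 1 n.+1) ('X - ((r * j)%N%:Z)%:P).
  rewrite rmorph_prod; apply: eq_bigr => j _.
  rewrite /= comp_polyB comp_polyX comp_polyC mulnDr muln1 PoszD polyCD.
  by rewrite opprD addrA addrK.
rewrite mxevalM mxevalX mulmxA (@mxeval_intertwine _ _ _ (DUmx C n)) ?mulmxA //.
by rewrite IH mulmx0 mul0mx.
Qed.

(** Every [a i] divides the annihilating product of distinct linear factors. A root of [a i] is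
    shared by all later terms of the chain, and the nullity at that root bounds their number. *)
Lemma decomp_roots n S v a i : cyclic_decomp (DUmx C n) S v a -> (i < S)%N ->
  exists js : seq nat, [/\ uniq js,
    a i = \prod_(j <- js) ('X - ((r * j)%N%:Z)%:P)
    & forall j, j \in js -> (0 < j <= n.+1)%N /\ (S - i <= rank_diff (n.+1 - j))%N].
Proof.
move=> dec lt_i; have [span indep ann mon chain] := dec.
have [m Em] : exists m, a i =
    \prod_(c <- mask m [seq (r * j)%N%:Z | j <- iota 1 n.+1]) ('X - c%:P).
  apply: monic_dvd_prod_XsubC; first exact: mon.
  set P := \prod_(_ <- _) _.
  pose F j := if j == i then P else 0.
  have -> : P = F i by rewrite /F eqxx.
  apply: indep lt_i; apply: big1 => j _; rewrite /F.
  by case: eqP => _; rewrite ?DUmx_annihilator ?mxeval0 mulmx0.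
exists (mask m (iota 1 n.+1)); split.
- by rewrite mask_uniq ?iota_uniq.
- by rewrite Em -map_mask big_map.
move=> j js; have Hj : (0 < j <= n.+1)%N.
  by have := mem_mask js; rewrite mem_iota; lia.
split=> //; have Hn := nullity_DUmx Hj.
have rt : root (a i) (r * j)%N%:Z.
  by rewrite Em root_prod_XsubC -map_mask; apply/mapP; exists j.
have dec' : cyclic_decomp (DUmx C n) (i + (S - i)) v a by rewrite subnKC ?(ltnW lt_i).
have := root_count dec' _ rt; rewrite subn_gt0 => /(_ lt_i).
lia.
Qed.

Lemma prod_roots_at0 (js : seq nat) :
  (\prod_(j <- js) ('X - ((r * j)%N%:Z)%:P)).[0] = \prod_(j <- js) - (r * j)%N%:Z.
Proof.
by rewrite horner_prod; apply: eq_bigr => j _; rewrite hornerXsubC sub0r.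
Qed.

Lemma has_rcf_DUmxS n : has_rcf (DUmx C n) ->
  dp p (n.+1%:Z - 1 - (r == 1%N)%:Z) + 1 <= dp p n.+1%:Z -> has_rcf (DUmx C n.+1).
Proof.
move=> /has_rcf_cyclic_decomp[s [v0 [a0 [dec0 _]]]] growth.
(* [k] is the rank of the kernel of D. Padding by [k] trivial summands provides the [k] top indices,
   however small [s] is. *)
set k := rank_diff n.+1.
have [v [a dec]] : exists v a, cyclic_decomp (DUmx C n) (s + k) v a.
  by rewrite addnC; do 2 eexists; apply: cyclic_decomp_pad dec0.
have [X XD] := Dmx_section n; have [Y UY] := Umx_retraction n.
(* Here each root r j is shared by more than [k] summands. By [rank_diff_ge] this forces r j = 1, so
   the value at 0 is 1 or -1. *)
have low i : (i < s)%N -> (a i).[0] * (a i).[0] = 1.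
  move=> lt_i; have [|js [_ -> Hjs]] := decomp_roots dec (i := i); first by lia.
  rewrite prod_roots_at0 -big_split /= big_seq big1 // => j /Hjs[Hj Hk].
  rewrite mulrNN; have [->//|/(rank_diff_ge Hj)] := eqVneq (r * j)%N 1%N.
  by move: Hk; rewrite -/k; lia.
have high : (0 < k)%N -> ((a s).[0] %| 3)%Z.
  move=> k_gt0; have [|js [ujs -> Hjs]] := decomp_roots dec (i := s); first by lia.
  rewrite prod_roots_at0.
  (* A root gives [k <= rank_diff (n.+1 - j)], while growth puts [rank_diff n] (for r = 1, that of n
     - 1) strictly below [k]. Applying [rank_diff_ge] one rank lower (for r = 1, two) excludes the
     other roots; for r = 1 the values 1 and 3 of [j] escape. *)
  have {}Hjs j : j \in js -> (r == 1%N) && ((j == 1%N) || (j == 3)).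
    move=> /Hjs[Hj]; rewrite addKn => Hk.
    case: eqP growth => [r1|r1] growth; last first.
      have {}growth : (rank_diff n < k)%N.
        have : n.+1%:Z - 1 - 0 = n%:Z by lia.
        by move: growth => /[swap] ->; rewrite !rank_diffE; lia.
      suff : (rank_diff (n.+1 - j) <= rank_diff n)%N by lia.
      have [->|j1] := eqVneq j 1%N; first by rewrite subn1.
      have [m En] : exists m, n = m.+1 by exists n.-1; lia.
      have -> : (n.+1 - j = m.+1 - j.-1)%N by lia.
      by rewrite En; apply: rank_diff_ge; [lia | rewrite muln_eq1; lia].
    have [//|j1] := eqVneq j 1%N; have [//|j3] := eqVneq j 3.
    have [m En] : exists m, n = m.+1 by exists n.-1; lia.
    have {}growth : (rank_diff m < k)%N.
      have : n.+1%:Z - 1 - 1 = m%:Z by lia.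
      by move: growth => /[swap] ->; rewrite !rank_diffE; lia.
    suff : (rank_diff (n.+1 - j) <= rank_diff m)%N by lia.
    have [->|j2] := eqVneq j 2; first by rewrite En subn2.
    have [m' Em] : exists m', m = m'.+1 by exists m.-1; lia.
    have -> : (n.+1 - j = m'.+1 - j.-2)%N by lia.
    by rewrite Em; apply: rank_diff_ge; [lia | rewrite muln_eq1; lia].
  (* All roots other than 3 equal 1, so [u] is a unit. As [js] has no repetition, the value of [a s]
     at 0 is [u] or -3 times [u]. *)
  pose u := \prod_(j <- js | j != 3) - (r * j)%N%:Z.
  have /unitrPr[u' uu'] : u \is a GRing.unit.
    rewrite /u big_seq_cond; apply: rpred_prod => j /andP[/Hjs/andP[/eqP ->]].
    by case/orP=> /eqP ->.
  have [j3|j3] := boolP (3 \in js); last first.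
    suff -> : \prod_(j <- js) - (r * j)%N%:Z = u.
      by apply/dvdzP; exists (3 * u'); rewrite -mulrA [u' * u]mulrC uu'.
    rewrite /u [LHS]big_seq [RHS]big_seq_cond; apply: eq_bigl => j.
    by case: (boolP (j \in js)) => //= jjs; symmetry; apply: contraNneq j3 => <-.
  rewrite (bigD1_seq 3) //= -/u; have /andP[/eqP -> _] := Hjs _ j3.
  by apply/dvdzP; exists (- u'); rewrite mulNr mulNr mulrN opprK mulrCA [u' * u]mulrC uu'.
have [w [b dec']] := cyclic_decomp_extension (rank_diffS n) XD UY dec low high.
by rewrite DUmxS; apply: cyclic_decomp_has_rcf (cyclic_decomp_addC r%:Z dec').
Qed.

End DifferentialPoset.

(** * From the rational canonical form to the Smith normal form *)

Notation polymx := (map_mx (@polyC int)).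

Section Evaluation.
Variables (N : nat) (A : 'M[int]_N).
Local Notation B := (char_poly_mx A).

(** The Z[x]-linear map from Z[x]^N onto Z^N, with x acting by [A], that fixes the standard basis
    vectors. Its kernel is the row span of [char_poly_mx A]. *)
Definition rowev (f : 'rV[{poly int}]_N) : 'rV[int]_N :=
  \sum_j row j (mxeval A (f 0 j)).

Lemma rowevD f g : rowev (f + g) = rowev f + rowev g.
Proof. by rewrite -big_split; apply: eq_bigr => j _; rewrite mxE mxevalD raddfD. Qed.

Lemma rowev0 : rowev 0 = 0.
Proof. by apply: big1 => j _; rewrite mxE mxeval0 row0. Qed.

Lemma rowevN f : rowev (- f) = - rowev f.
Proof. by apply/eqP; rewrite -addr_eq0 -rowevD addNr rowev0. Qed.

Lemma rowev_sum I (s : seq I) (P : pred I) F :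
  rowev (\sum_(i <- s | P i) F i) = \sum_(i <- s | P i) rowev (F i).
Proof. exact: (big_morph _ rowevD rowev0). Qed.

Lemma rowevZ (g : {poly int}) f : rowev (g *: f) = rowev f *m mxeval A g.
Proof.
rewrite mulmx_suml; apply: eq_bigr => j _.
by rewrite mxE mulrC mxevalM row_mul.
Qed.

Lemma rowevC u : rowev (polymx u) = u.
Proof.
rewrite [RHS]row_sum_delta; apply: eq_bigr => j _.
by rewrite mxE mxevalC -scalemx1 !rowE -scalemxAr mulmx1.
Qed.

Lemma rowev_mulmx m (h : 'rV[{poly int}]_m) (M : 'M[{poly int}]_(m, N)) :
  rowev (h *m M) = \sum_i rowev (row i M) *m mxeval A (h 0 i).
Proof. by rewrite mulmx_sum_row rowev_sum; apply: eq_bigr => i _; rewrite rowevZ. Qed.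

Lemma rowev_char_row i : rowev (row i B) = 0.
Proof.
have -> : row i B = 'X *: polymx (delta_mx 0 i) - polymx (row i A).
  apply/rowP => j; rewrite !mxE eq_sym /=.
  by case: eqP => _; rewrite ?mulr1n ?mulr0n /= ?polyC0 ?polyC1 ?mulr1 ?mulr0.
by rewrite rowevD rowevN rowevZ !rowevC mxevalX -rowE subrr.
Qed.

Lemma rowev_char_mul h : rowev (h *m B) = 0.
Proof.
by rewrite rowev_mulmx; apply: big1 => i _; rewrite rowev_char_row mul0mx.
Qed.

(** Modulo the rows of xI - A, multiplying a constant row by x amounts to applying A, so every row
    reduces to a constant one. *)
Lemma char_poly_mx_division f : exists (h : 'rV_N) u, f = h *m B + polymx u.
Proof.
have scaled (g : {poly int}) : forall u, exists (h : 'rV_N) w, g *: polymx u = h *m B + polymx w.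
  elim/poly_ind: g => [|g c IH] u.
    by exists 0, 0; rewrite scale0r mul0mx map_mx0 addr0.
  have [h [w E]] := IH (u *m A).
  exists (g *: polymx u + h), (w + c *: u).
  have uB : polymx u *m B = 'X *: polymx u - polymx (u *m A).
    by rewrite /char_poly_mx mulmxBr mul_mx_scalar map_mxM.
  rewrite map_mxD map_mxZ mulmxDl -scalemxAl uB scalerBr E scalerA scalerDl.
  by rewrite -[RHS]addrA [h *m B + (_ + _)]addrA [RHS]addrA subrK.
rewrite [f]row_sum_delta.
elim/big_ind: _ => [|x y [h1 [u1 ->]] [h2 [u2 ->]]|j _].
- by exists 0, 0; rewrite mul0mx map_mx0 addr0.
- by exists (h1 + h2), (u1 + u2); rewrite mulmxDl map_mxD addrACA.
- have [h [u E]] := scaled (f 0 j) (delta_mx 0 j); exists h, u; rewrite -E.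
  by congr (_ *: _); apply/rowP => i; rewrite !mxE rmorph_nat.
Qed.

Lemma rowev_ker f : rowev f = 0 -> exists h : 'rV_N, f = h *m B.
Proof.
have [h [u ->]] := char_poly_mx_division f.
by rewrite rowevD rowev_char_mul rowevC add0r => ->; exists h; rewrite map_mx0 addr0.
Qed.

Lemma char_poly_mx_reg (L : 'M[{poly int}]_N) : L *m B = B -> L = 1%:M.
Proof.
move=> LB; have : (L - 1%:M) *m (B *m \adj B) = 0.
  by rewrite mulmxA mulmxBl LB mul1mx subrr mul0mx.
rewrite mul_mx_adj mul_mx_scalar => /eqP; rewrite scalemx_eq0.
by rewrite (negPf (monic_neq0 (char_poly_monic A))) subr_eq0 => /eqP.
Qed.

(** The rows of [W] form a basis of Z[x]^N lifting the generators, so the kernel of [rowev] is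
    spanned both by the rows of [B] and by the [a i] multiples of the rows of [W]. The two
    transition matrices are inverse to each other because [B] can be cancelled. *)
Lemma smith_of_lift v a (W X : 'M[{poly int}]_N) : cyclic_decomp A N v a ->
  (forall i, rowev (row i W) = v i) -> X *m W = 1%:M ->
  exists2 L : 'M_N, L \in unitmx & L *m B = diag_mx (\row_i a i) *m W.
Proof.
move=> [_ indep ann mon _] evW XW; pose Dg := diag_mx (\row_(i < N) a i).
have [L EL] : exists L : 'M_N, L *m B = Dg *m W.
  have H i : exists h : 'rV_N, row i (Dg *m W) = h *m B.
    by apply: rowev_ker; rewrite row_diag_mul rowevZ evW mxE ann.
  have [L HL] := fin_all_exists H; exists (\matrix_i L i).
  by apply/row_matrixP => i; rewrite row_mul rowK HL.
have [L' EL'] : exists L' : 'M_N, B = L' *m (Dg *m W).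
  have H i : exists h : 'rV_N, row i B = h *m (Dg *m W).
    pose c := row i B *m X.
    have cW : c *m W = row i B by rewrite -mulmxA XW mulmx1.
    have Hc (j : 'I_N) : exists g, c 0 j = g * a j.
      pose cc j := if insub j is Some j' then c 0 j' else 0.
      have ccE (j' : 'I_N) : cc j' = c 0 j' by rewrite /cc valK.
      have := rowev_char_row i; rewrite -cW rowev_mulmx => c0.
      rewrite -ccE; apply: indep => //; rewrite -[RHS]c0.
      by apply: eq_bigr => j' _; rewrite ccE evW.
    have [g Hg] := fin_all_exists Hc; exists (\row_j g j).
    rewrite -cW mulmxA; congr (_ *m W); apply/rowP => j.
    by rewrite Hg mul_mx_diag !mxE.
  have [L' HL'] := fin_all_exists H; exists (\matrix_i L' i).
  by apply/row_matrixP => i; rewrite [RHS]row_mul rowK -HL'.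
exists L => //.
have /mulmx1_unit[] // : L' *m L = 1%:M.
by apply: char_poly_mx_reg; rewrite -mulmxA EL -EL'.
Qed.

End Evaluation.

Section LiftConstruction.
Variables (N : nat) (A : 'M[int]_N) (S : nat).
Variables (v : nat -> 'rV[int]_N) (a : nat -> {poly int}).
Hypothesis dec : cyclic_decomp A S v a.
Hypothesis sz_a : forall i, (i < S)%N -> (1 < size (a i))%N.

Let u i j := v i *m mxeval A 'X^j.

(** The vectors v_i A^j with j below the degree of a_i are independent in Z^N. *)
Lemma sum_degrees_le : (\sum_(i < S) (size (a i)).-1 <= N)%N.
Proof.
have [_ indep _ mon _] := dec.
pose T : finType := {i : 'I_S & 'I_(size (a i)).-1}.
have <- : #|T| = \sum_(i < S) (size (a i)).-1.
  by rewrite card_tagged sumnE big_map big_enum; apply: eq_bigr => i _; rewrite card_ord.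
pose y := \matrix_(t < #|T|) u (tag (enum_val t)) (tagged (enum_val t)).
(* A zero matrix without columns brings the goal into the form of [indep_rows_rank]. *)
suff : (#|T| + \rank (ratmx (0 : 'M[int]_(N, 0))) <= N)%N by rewrite map_mx0 mxrank0 addn0.
apply: (@indep_rows_rank _ _ _ y); last by rewrite mulmx0.
move=> c cy; pose c' (t : T) := c 0 (enum_rank t).
pose G (i : 'I_S) : {poly int} :=
  \sum_(j < (size (a i)).-1) c' (Tagged (fun i : 'I_S => 'I_(size (a i)).-1) j) *: 'X^j.
pose F i := if insub i is Some i' then G i' else 0.
have FE (i : 'I_S) : F i = G i by rewrite /F valK.
have szG i : (size (G i) < size (a i))%N.
  rewrite -[X in (_ < X)%N](ltn_predK (sz_a (ltn_ord i))) ltnS.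
  apply: leq_trans (size_sum _ _ _) _; apply/bigmax_leqP => j _.
  apply: leq_trans (size_scale_leq _ _) _.
  by rewrite size_polyXn.
have G0 i : G i = 0.
  apply: pdvd_small (szG i); rewrite -FE; apply: indep => //.
  transitivity (\sum_(t : T) c' t *: u (tag t) (tagged t)).
    have := @sig_big_dep _ 0 +%R 'I_S (fun i => 'I_(size (a i)).-1) predT (fun _ => predT)
      (fun i j => c' (Tagged (fun i : 'I_S => 'I_(size (a i)).-1) j) *: u i j).
    rewrite (eq_bigr (fun t => c' t *: u (tag t) (tagged t))); last by case.
    move=> /= <-; apply: eq_bigr => i' _; rewrite FE mxeval_sum mulmx_sumr.
    by apply: eq_bigr => j _; rewrite mxevalZ scalemxAr.
  rewrite -[RHS]cy mulmx_sum_row (reindex _ (onW_bij _ (enum_rank_bij T))) /=.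
  by apply: eq_bigr => t _; rewrite rowK enum_rankK.
apply/rowP => t; rewrite mxE; have := G0 (tag (enum_val t)).
move/polyP/(_ (tagged (enum_val t))); rewrite coef0 coef_sum.
rewrite (bigD1 (tagged (enum_val t))) //= coefZ coefXn eqxx mulr1 big1 ?addr0.
  by rewrite /c'; case: (enum_val t) (enum_valK t) => i j /= ->.
move=> j /negPf nej; rewrite coefZ coefXn eq_sym.
by rewrite (_ : (_ == _) = false) ?mulr0.
Qed.

(** The generators lift to the constant rows [v i], and the padded zeros to the kernel elements
    [R t]. Together these produce every v_i A^j with j below the degree of a_i, hence all constant
    rows, which span Z[x]^N. *)
Lemma exists_unimodular_lift : exists W X : 'M[{poly int}]_N,
  (forall i : 'I_N, rowev A (row i W) =
     if (i < N - S)%N then 0 else v (i - (N - S))%N) /\ X *m W = 1%:M.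
Proof.
have [span _ ann mon _] := dec.
pose T : finType := {i : 'I_S & 'I_(size (a i)).-2}.
(* [T] counts the degree of each [a i] minus one, so the rows [R t] fit into the first [N - S]
   positions. *)
have cardT : (#|T| + S <= N)%N.
  apply: leq_trans sum_degrees_le.
  rewrite card_tagged sumnE big_map big_enum /= -[X in (_ + X <= _)%N]card_ord.
  rewrite -sum1_card -big_split /=.
  apply: leq_sum => i _; rewrite card_ord; have := sz_a (ltn_ord i).
  by case: (size (a i)) => [|[|n]] // _; rewrite addn1.
pose R (t : T) : 'rV[{poly int}]_N :=
  polymx (u (tag t) (tagged t).+1) - 'X *: polymx (u (tag t) (tagged t)).
have uS i j : u i j.+1 = u i j *m A by rewrite /u exprSr mxevalM mxevalX mulmxA.
pose W := \matrix_(t < N) (if (t < N - S)%N then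
   if insub (val t) is Some t' then R (enum_val (t' : 'I_#|T|)) else 0
   else polymx (v (t - (N - S))%N)).
pose sp f := exists h : 'rV[{poly int}]_N, f = h *m W.
have sp0 : sp 0 by exists 0; rewrite mul0mx.
have spD f g : sp f -> sp g -> sp (f + g).
  by move=> [h ->] [h' ->]; exists (h + h'); rewrite mulmxDl.
have spZ c f : sp f -> sp (c *: f).
  by move=> [h ->]; exists (c *: h); rewrite scalemxAl.
have spW t : sp (row t W) by exists (delta_mx 0 t); rewrite -rowE.
have spv i : (i < S)%N -> sp (polymx (v i)).
  move=> lt_i; have lt_t : (N - S + i < N)%N by lia.
  have := spW (Ordinal lt_t); rewrite rowK /= ltnNge leq_addr /= addKn.
  by [].
have spR t : sp (R t).
  have lt_tS : (enum_rank t < N - S)%N.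
    by rewrite ltn_subRL addnC; apply: leq_trans cardT; rewrite ltn_add2r.
  have lt_t : (enum_rank t < N)%N := leq_trans lt_tS (leq_subr _ _).
  have := spW (Ordinal lt_t); rewrite rowK /= lt_tS.
  by rewrite valK enum_rankK.
have spu i j : (i < S)%N -> (j < (size (a i)).-1)%N -> sp (polymx (u i j)).
  move=> lt_i; elim: j => [_|j IH lt_j].
    by rewrite /u expr0 mxeval1 mulmx1; apply: spv.
  have lt_j' : (j < (size (a (Ordinal lt_i))).-2)%N.
    by move: lt_j => /=; case: (size (a i)) => [|[|n]].
  have -> : polymx (u i j.+1) =
      R (Tagged (fun i : 'I_S => 'I_(size (a i)).-2) (Ordinal lt_j'))
      + 'X *: polymx (u i j) by rewrite /R subrK.
  by apply: spD; [apply: spR | apply/spZ/IH/ltnW].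
have sum_sp I (s : seq I) F : (forall i, sp (F i)) -> sp (\sum_(i <- s) F i).
  by move=> spF; apply: big_ind.
have spvf i f : (i < S)%N -> sp (polymx (v i *m mxeval A f)).
  (* Reducing [f] modulo [a i] leaves only powers covered by [spu]. *)
  move=> lt_i; rewrite (Pdiv.RingMonic.rdivp_eq (mon i lt_i) f) mxevalD mulmxDr.
  rewrite mulrC mxevalM mulmxA ann // mul0mx add0r.
  have : (size (Pdiv.Ring.rmodp f (a i)) < size (a i))%N.
    by rewrite Pdiv.Ring.ltn_rmodpN0 // monic_neq0 ?mon.
  move: (Pdiv.Ring.rmodp f (a i)) => g szg.
  rewrite -[g]coefK poly_def mxeval_sum mulmx_sumr raddf_sum; apply: sum_sp => j.
  rewrite /= mxevalZ -scalemxAr map_mxZ; apply/spZ/spu => //.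
  by apply: leq_trans (ltn_ord j) _; rewrite -ltnS (ltn_predK szg).
have spC w : sp (polymx w).
  by have [f ->] := span w; rewrite raddf_sum; apply: sum_sp => i; apply: spvf.
have [X HX] := fin_all_exists (fun i : 'I_N => spC (delta_mx 0 i)).
exists W, (\matrix_i X i); split=> [i|]; last first.
  apply/row_matrixP => i; rewrite row_mul rowK -HX row1.
  by apply/rowP => j; rewrite !mxE rmorph_nat.
rewrite rowK; case: ifP => _; last exact: rowevC.
case: insubP => [t' _ _|_]; last exact: rowev0.
by rewrite rowevD rowevN rowevZ !rowevC mxevalX uS subrr.
Qed.

End LiftConstruction.

(** The substitution of -x for x carries xI - A to -(A + xI), so a Smith form of the characteristic
    matrix suffices. Padding to N summands puts the [a i], preceded by ones, on its diagonal. *)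
Lemma has_rcf_has_snf N (A : 'M[int]_N) : has_rcf A ->
  has_snf (map_mx polyC A + 'X *: (1%:M : 'M[{poly int}]_N)).
Proof.
move=> /has_rcf_cyclic_decomp[S [v [a [dec sz_a]]]].
have [W [X [evW XW]]] := exists_unimodular_lift dec sz_a.
have SN : (S <= N)%N.
  apply: leq_trans (sum_degrees_le dec sz_a); rewrite -[X in (X <= _)%N]card_ord -sum1_card.
  by apply: leq_sum => i _; have := sz_a i (ltn_ord i); lia.
have := cyclic_decomp_pad (N - S) dec; rewrite subnK //.
set v' := fun i => _; set a' := fun i => _ => dec'.
have [L uL EL] := smith_of_lift dec' evW XW.
have [_ uW] := mulmx1_unit XW.
pose sg := comp_poly (- 'X : {poly int}).
have unit_sg (M : 'M[{poly int}]_N) : M \in unitmx -> map_mx sg M \in unitmx.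
  move=> uM; have /mulmx1_unit[] // : map_mx sg M *m map_mx sg (invmx M) = 1%:M.
  by rewrite -map_mxM mulmxV // map_mx1.
exists (- map_mx sg L), (map_mx sg (invmx W)), (fun i => sg (a' i)); split.
- by rewrite -scaleN1r unitmxZ ?unit_sg // unitrN unitr1.
- by apply: unit_sg; rewrite unitmx_inv.
- have -> : map_mx polyC A + 'X *: 1%:M = - map_mx sg (char_poly_mx A).
    apply/matrixP => i j; rewrite !mxE /sg comp_polyB comp_polyC raddfMn /= comp_polyX.
    by rewrite mulr_natr mulNrn opprB opprK.
  rewrite mulNmx mulmxN opprK -map_mxM EL -map_mxM mulmxK //.
  apply/matrixP => i j; rewrite !mxE raddfMn /= -val_eqE /=.
  by case: eqP => _; rewrite ?mulr1n ?mulr0n.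
move=> i j; rewrite minnn => ij; have [_ _ _ _ chain] := dec'.
by have [g Eg] := chain i j ij; exists (sg g); rewrite Eg /sg comp_polyM.
Qed.

Theorem mainTheorem6 (r : nat) (p : nat -> nat)
    (C : forall n, 'I_(p n) -> 'I_(p n.+1) -> bool) :
  (0 < r)%N ->
  differential C r ->
  (* (i) D_n surjective for n >= 1 *)
  (forall n (w : 'rV[int]_(p n)), exists u : 'rV[int]_(p n.+1), u *m Dmx C n = w) ->
  (exists l : nat,
     (* (ii) *)
     (forall n : nat, (l.+1 <= n)%N ->
        dp p (n%:Z - 1 - (r == 1%N)%:Z) + 1 <= dp p n%:Z) /\
     (* (iii) *)
     (forall n : nat, (n <= l)%N -> has_rcf (DUmx C n))) ->
  forall n : nat,
    has_rcf (DUmx C n) /\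
    has_snf (map_mx polyC (DUmx C n) + 'X *: (1%:M : 'M[{poly int}]_(p n))).
Proof.
move=> r_gt0 diffC surjD [l [growth rcf_le]] n.
suff rcf : has_rcf (DUmx C n) by split=> //; apply: has_rcf_has_snf.
elim: n => [|n IH]; first exact: rcf_le.
have [le_nl|lt_ln] := leqP n.+1 l; first exact: rcf_le.
apply: (has_rcf_DUmxS r_gt0 diffC surjD IH).
exact: growth.
Qed.
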